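(* Let $\varphi\colon[0,1]\to[0,\infty)$ be an increasing, concave function with $\varphi(0)=0$ and having non-trivial dilation indices $0<\gamma_\varphi\le\delta_\varphi<1$. (a) For the Lorentz space $X=\Lambda(\varphi)$, the Banach function space $[\mathcal{C},X]$ is order isomorphic to an AL-space. (b) For the Marcinkiewicz space $X=M(\varphi)$, the Banach function space $[\mathcal{C},X]$ is not order isomorphic to an AL-space.
   Context: For a measurable function $f$ on $[0,1]$ (with Lebesgue measure $\lambda$), $f^*$ denotes its decreasing rearrangement (right-continuous inverse of $\tau\mapsto\lambda(\{|f|>\tau\})$). Functions are real-valued. The lower and upper dilation indices of a function $\varphi$ positive on $(0,1]$ are $$\gamma_\varphi:=\lim_{t\to0^+}\frac{\log\left(\sup_{0<s\le1}\varphi(st)/\varphi(s)\right)}{\log t},\qquad \delta_\varphi:=\lim_{t\to+\infty}\frac{\log\left(\sup_{0<s\le1/t}\varphi(st)/\varphi(s)\right)}{\log t}.$$ The Lorentz space $\Lambda(\varphi)$ consists of all measurable $f$ on $[0,1]$ with $\|f\|_{\Lambda(\varphi)}:=\int_0^1 f^*(s)\,d\varphi(s)<\infty$. The Marcinkiewicz space $M(\varphi)$ consists of all measurable $f$ with $\|f\|_{M(\varphi)}:=\sup_{0<t\le1}\frac{\varphi(t)}{t}\int_0^t f^*(s)\,ds<\infty$. The Cesàro operator is $\mathcal{C}(f)(x):=\frac1x\int_0^x f(t)\,dt$, and $[\mathcal{C},X]:=\{f:\mathcal{C}(|f|)\in X\}$ with norm $\|f\|_{[\mathcal{C},X]}:=\|\mathcal{C}(|f|)\|_X$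 and the a.e. order. An AL-space is a Banach lattice in which the norm is additive over disjoint functions (elements). Order isomorphic means isomorphic via a linear lattice isomorphism that is a homeomorphism (not necessarily isometric). *)

(* Defs.v *)
From HB Require Import structures.
From mathcomp Require Import all_boot all_order all_algebra.
From mathcomp Require Import all_classical all_reals all_analysis.
From mathcomp Require Import measurable_realfun.

Set Implicit Arguments.
Unset Strict Implicit.
Unset Printing Implicit Defensive.
Import Order.TTheory GRing.Theory Num.Theory.
Import numFieldNormedType.Exports.
Local Open Scope classical_set_scope.
Local Open Scope ring_scope.

(* Functions on [0,1] are functions on R of which only the values on `[0, 1]
   matter. *)

Section dilation_indices.
Context {R : realType}.
Implicit Type phi : R -> R.

(* The suprema and both limits exist in R when phi is positive on ]0, 1],
   nondecreasing and concave. *)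
Definition lower_dilation_index phi : R :=
  lim (ln (sup [set phi (s * t) / phi s | s in `]0, 1]]) / ln t @[t --> 0^'+]).

Definition upper_dilation_index phi : R :=
  lim (ln (sup [set phi (s * t) / phi s | s in `]0, t^-1]]) / ln t @[t --> +oo]).

End dilation_indices.

Section stieltjes.
Context {R : realType}.
Variable phi : R -> R.

(* Right-continuous version of a nonnegative nondecreasing function phi on
   [0,1], extended by phi 0 to the left and by phi 1 to the right (see
   stieltjes_cdfE). The truncation by 0 makes it a cumulative function
   whatever phi is. *)
Definition stieltjes_cdf (x : R) : R :=
  inf [set Num.max 0 (phi (Num.max 0 (Num.min 1 y))) | y in `]x, +oo[].

Let cdf_set (x : R) : set R :=
  [set Num.max 0 (phi (Num.max 0 (Num.min 1 y))) | y in `]x, +oo[].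

Let cdf_has_inf x : has_inf (cdf_set x).
Proof.
split.
  exists (Num.max 0 (phi (Num.max 0 (Num.min 1 (x + 1))))), (x + 1) => //=.
  by rewrite in_itv/= andbT ltrDl.
by exists 0 => _ [y _ <-]; rewrite le_max lexx.
Qed.

Let cdf_nd : nondecreasing stieltjes_cdf.
Proof.
move=> x y xy; apply: lb_le_inf; first exact: (cdf_has_inf y).1.
move=> _ [z /= zy <-]; apply: ge_inf; first exact: (cdf_has_inf x).2.
exists z => //=; move: zy; rewrite !in_itv/= !andbT; exact: le_lt_trans.
Qed.

Let cdf_rc : right_continuous stieltjes_cdf.
Proof.
move=> x; apply/cvgrPdist_lt => e e0.
have [_ [y /= xy <-] ye] := inf_adherent e0 (cdf_has_inf x).
move: xy; rewrite in_itv/= andbT => xy.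
near=> z.
have xz : x < z by near: z; exact: nbhs_right_gt.
have zy : z < y by near: z; exact: nbhs_right_lt.
rewrite ler0_norm ?subr_le0 ?cdf_nd ?(ltW xz)// opprB ltrBlDl.
apply: le_lt_trans ye; apply: ge_inf; first exact: (cdf_has_inf z).2.
by exists y => //=; rewrite in_itv/= zy.
Unshelve. all: by end_near. Qed.

HB.instance Definition _ :=
  isCumulative.Build R _ R stieltjes_cdf cdf_nd cdf_rc.

Lemma stieltjes_cdfE :
  {in `[0, 1], forall x, 0 <= phi x} ->
  {in `[0, 1] &, {homo phi : x y / x <= y}} ->
  {in `[0, 1[, forall x, phi y @[y --> x^'+] --> phi x} ->
  {in `[0, 1], stieltjes_cdf =1 phi}.
Proof.
move=> phi_ge0 phi_nd phi_rc x x01.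
have := x01; rewrite in_itv/= => /andP[x0 x1].
have cl (y : R) : Num.max 0 (Num.min 1 y) \in `[0, 1].
  rewrite in_itv/=. by rewrite le_max lexx/= ge_max ler01 ge_min lexx.
apply/eqP; rewrite eq_le; apply/andP; split; last first.
  apply: lb_le_inf; first exact: (cdf_has_inf x).1.
  move=> _ [y /= + <-]; rewrite in_itv/= andbT => xy.
  rewrite le_max; apply/orP; right; apply: phi_nd => //.
  by rewrite le_max le_min x1 (ltW xy) orbT.
move: x1; rewrite le_eqVlt => /predU1P[xE|x1].
  apply: ge_inf; first exact: (cdf_has_inf x).2.
  exists 2 => /=; first by rewrite in_itv/= andbT xE ltr1n.
  by rewrite min_l ?ler1n// max_r ?ler01// -xE max_r// phi_ge0.
have phix := phi_rc x; rewrite in_itv/= x0 x1 in phix.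
apply/ler_addgt0Pr => e e0.
move/cvgrPdist_lt : (phix isT) => /(_ _ e0) phie.
near (x^'+) => y.
have xy : x < y by near: y; exact: nbhs_right_gt.
have y1 : y < 1 by near: y; exact: nbhs_right_lt.
have y0 : 0 <= y by rewrite (le_trans x0)// ltW.
have y01 : y \in `[0, 1] by rewrite in_itv/= y0 ltW.
apply: (@le_trans _ _ (phi y)).
  apply: ge_inf; first exact: (cdf_has_inf x).2.
  exists y => /=; first by rewrite in_itv/= xy.
  by rewrite min_r ?(ltW y1)// max_r// max_r// phi_ge0.
rewrite -lerBlDl; apply: (le_trans (ler_norm _)); rewrite distrC; apply: ltW.
by near: y.
Unshelve. all: by end_near. Qed.

End stieltjes.

Section rearrangement_invariant_spaces.
Context {R : realType}.
Local Open Scope ereal_scope.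
Local Notation lambda := (@lebesgue_measure R).
Implicit Types (phi : R -> R) (h : R -> \bar R).

Definition rearrangement h (s : R) : \bar R :=
  ereal_inf [set t%:E | t in
    [set t : R | (0 <= t)%R /\
       lambda (`[0%R, 1%R] `&` [set x | t%:E < `|h x|]) <= s%:E]].

Definition lorentz_norm phi h : \bar R :=
  \int[lebesgue_stieltjes_measure (stieltjes_cdf phi)]_(s in `[0%R, 1%R])
     rearrangement h s.

Definition marcinkiewicz_norm phi h : \bar R :=
  ereal_sup [set (phi t / t)%:E * \int[lambda]_(s in `[0%R, t]) rearrangement h s
            | t in `]0%R, 1%R]].

(* Extended-real-valued representatives, finite a.e., are allowed because
   the Cesaro averages of |f| may be infinite on a null set. *)
Definition finite_norm_space (N : (R -> \bar R) -> \bar R) : set (R -> \bar R) :=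
  [set h : R -> \bar R | [/\ measurable_fun (`[0%R, 1%R] : set R) h,
               {ae lambda, forall x, x \in `[0%R, 1%R] -> h x \is a fin_num} &
               N h < +oo]].

Definition lorentz_space phi := finite_norm_space (lorentz_norm phi).

Definition marcinkiewicz_space phi := finite_norm_space (marcinkiewicz_norm phi).

(* Only used for f >= 0, where the integral may be +oo. *)
Definition cesaro_op (f : R -> R) (x : R) : \bar R :=
  (x^-1)%:E * \int[lambda]_(t in `[0%R, x]) (f t)%:E.

Definition cesaro_space (X : set (R -> \bar R)) : set (R -> R) :=
  [set f : R -> R | measurable_fun (`[0%R, 1%R] : set R) f /\
     X (cesaro_op (fun x => `|f x|%R))].

Definition cesaro_norm (N : (R -> \bar R) -> \bar R) (f : R -> R) : \bar R :=
  N (cesaro_op (fun x => `|f x|%R)).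

End rearrangement_invariant_spaces.

(* Order.Lattice and CompleteNormedModule cannot be joined by HB (a missing
   join with Num.RealDomain), hence a record over completeNormedModType. *)
Record banach_lattice (R : realType) (E : completeNormedModType R) := BanachLattice {
  bl_le : rel E ;
  bl_join : E -> E -> E ;
  bl_meet : E -> E -> E ;
  bl_le_refl : reflexive bl_le ;
  bl_le_anti : antisymmetric bl_le ;
  bl_le_trans : transitive bl_le ;
  bl_leUx : forall x y z, bl_le (bl_join x y) z = bl_le x z && bl_le y z ;
  bl_lexI : forall x y z, bl_le z (bl_meet x y) = bl_le z x && bl_le z y ;
  bl_leD2r : forall x y z, bl_le x y -> bl_le (x + z) (y + z) ;
  bl_leZ2l : forall (a : R) x y, 0 <= a -> bl_le x y -> bl_le (a *: x) (a *: y) ;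
  bl_le_norm : forall x y,
    bl_le (bl_join x (- x)) (bl_join y (- y)) -> `|x| <= `|y|
}.

Section AL_spaces.
Context {R : realType} {E : completeNormedModType R}.
Implicit Type L : banach_lattice E.

Definition bl_abs L (x : E) : E := bl_join L x (- x).

Definition AL_space L : Prop :=
  forall x y : E, bl_meet L (bl_abs L x) (bl_abs L y) = 0 ->
    `|x + y| = `|x| + `|y|.

(* D is a space of measurable functions on [0,1], taken modulo a.e. equality
   and ordered a.e., with norm N; T is a map from D to E, given on
   representatives. *)
Definition order_isomorphism (D : set (R -> R)) (N : (R -> R) -> \bar R) L
    (T : (R -> R) -> E) : Prop :=
  [/\ (forall f g, D f -> D g ->
         T f = T g <-> ae_eq (@lebesgue_measure R) `[0, 1]%classic f g),
      (forall y, exists2 f, D f & T f = y),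
      (forall (a : R) f g, D f -> D g ->
         T (fun x => a * f x + g x) = a *: T f + T g),
      (forall f g, D f -> D g ->
         T (fun x => Num.max (f x) (g x)) = bl_join L (T f) (T g) /\
         T (fun x => Num.min (f x) (g x)) = bl_meet L (T f) (T g)) &
      (forall f, D f -> forall e : R, 0 < e -> exists2 r : R, 0 < r &
         forall g, D g -> (N (fun x => g x - f x)%R < r%:E)%E -> `|T g - T f| < e) /\
      (forall f, D f -> forall e : R, 0 < e -> exists2 r : R, 0 < r &
         forall g, D g -> `|T g - T f| < r -> (N (fun x => g x - f x)%R < e%:E)%E)].

End AL_spaces.

Definition order_isomorphic_to_AL_space (R : realType)
    (D : set (R -> R)) (N : (R -> R) -> \bar R) : Prop :=
  exists (E : completeNormedModType R) (L : banach_lattice E) (T : (R -> R) -> E),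
    AL_space L /\ order_isomorphism D N L T.

(* Main.v *)
(* (a) For f >= 0 put F x = \int_0^x f and h = F / x, the Cesaro average. As F is
   nondecreasing, h >= F s / (3 s) on ]s, 3 s] and h >= F (1 - 2 s) on
   ]1 - 2 s, 1], which bounds the rearrangement h^* from below at s by
   1/4 \int k(s, t) f(t) dt for an explicit kernel k; bounding h on
   [s / 2, 1 - s / 2] bounds h^* from above by another kernel. Integrating in s
   against d phi and exchanging the integrals, the two resulting weights in t
   are comparable because phi(a s) <= m phi(s) with m < 1 (positivity of the
   lower index). Hence [C, Lambda(phi)] is, up to equivalence of norms, the
   space L^1 of a weight, and L^1 is an AL-space.
   (b) As the upper index is < 1, \int_0^x 1 / phi <= K x / phi(x), so that
   1 / phi belongs to [C, M(phi)]. The dyadic pieces of 1 / phi are disjoint,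
   lie below 1 / phi, and have norm at least 1/4; in an AL-space the norms of
   disjoint elements below a fixed one have bounded sums. *)

From HB Require Import structures.
Require Import Defs.
From mathcomp Require Import all_boot all_order all_algebra.
From mathcomp Require Import all_classical all_reals all_analysis.
From mathcomp Require Import measurable_realfun ring lra.

Set Implicit Arguments.
Unset Strict Implicit.
Unset Printing Implicit Defensive.
Import Order.TTheory GRing.Theory Num.Theory.
Import numFieldNormedType.Exports.
Local Open Scope classical_set_scope.
Local Open Scope ring_scope.

(** * The Banach lattice L^1 *)

(** An order isomorphism needs only equivalent norms. This matters because the average [h] is not
    monotone and [h^*] has no usable formula, while each inequality needs only one well-chosen set.
    From below, the set must have measure strictly larger than [s], hence the intervals of length 2
    s; from above, the two end intervals left out may have total length at most [s]. Both ends of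
    [0, 1] count: mass of f at a point t close to 1 is seen by the average on [t, 1] only, so the
    weight decays there like phi(1 - t), whereas near 0 it is governed by the integral of d phi(s) /
    s over s > t. Near 1, concavity compares the two weights. Near 0, the upper weight has the extra
    term phi(t) / t, coming from s <= t, and the contraction serves to absorb it. In part (b) the
    lower bound is invariant under dilation, which is why the dyadic pieces of 1 / phi do not become
    small. *)

Section L1_space.
Context d (T : measurableType d) (R : realType).
Variables (mu : {measure set T -> \bar R}) (D : set T) (mD : measurable D).
Implicit Types f g h : T -> R.

Definition L1_fun : {pred T -> R} :=
  fun f => `[< mu.-integrable D (EFin \o f) >].

Lemma L1_funP f : reflect (mu.-integrable D (EFin \o f)) (f \in L1_fun).
Proof. exact: asboolP. Qed.

Record L1_repr := L1Repr { L1_val :> T -> R ; _ : L1_val \in L1_fun }.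

HB.instance Definition _ := [isSub for L1_val].
HB.instance Definition _ := [Choice of L1_repr by <:].

Definition L1_eq (f g : L1_repr) := `[< ae_eq mu D f g >].

Let L1_eq_refl : reflexive L1_eq.
Proof. by move=> f; apply/asboolP/ae_eq_refl. Qed.

Let L1_eq_sym : symmetric L1_eq.
Proof. by move=> f g; apply/asboolP/asboolP => /ae_eq_sym. Qed.

Let L1_eq_trans : transitive L1_eq.
Proof.
by move=> f g h /asboolP gf /asboolP fh; apply/asboolP/(ae_eq_trans gf fh).
Qed.

Canonical L1_equiv := EquivRel L1_eq L1_eq_refl L1_eq_sym L1_eq_trans.

Local Open Scope quotient_scope.

(* The proof [mD] is kept in the type for canonical structures to find it. *)
Definition L1 : Type := (fun _ : measurable D => {eq_quot L1_eq}) mD.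
HB.instance Definition _ := Choice.on L1.
HB.instance Definition _ := EqQuotient.on L1.

Lemma L1_fun0 : (cst 0 : T -> R) \in L1_fun.
Proof. exact/L1_funP/integrable0. Qed.

Lemma L1_funD f g : f \in L1_fun -> g \in L1_fun -> (fun x => f x + g x) \in L1_fun.
Proof. by move=> /L1_funP fi /L1_funP gi; apply/L1_funP/(integrableD mD fi gi). Qed.

Lemma L1_funZ (a : R) f : f \in L1_fun -> (fun x => a * f x) \in L1_fun.
Proof. by move=> /L1_funP fi; apply/L1_funP/(integrableZl mD a fi). Qed.

Lemma L1_fun_le f g : measurable_fun D g -> (forall x, D x -> `|g x| <= f x) ->
  f \in L1_fun -> g \in L1_fun.
Proof.
move=> mg gf /L1_funP fi; apply/L1_funP; apply: le_integrable fi => //.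
  exact/measurable_EFinP.
by move=> x Dx /=; rewrite lee_fin (le_trans (gf x Dx)) ?ler_norm.
Qed.

Lemma L1_fun_measurable f : f \in L1_fun -> measurable_fun D f.
Proof. by move=> /L1_funP /measurable_int /measurable_EFinP. Qed.

Lemma L1_fun_norm f : f \in L1_fun -> (fun x => `|f x|) \in L1_fun.
Proof. by move=> /L1_funP fi; apply/L1_funP; exact: integrable_norm. Qed.

Lemma L1_funN f : f \in L1_fun -> (fun x => - f x) \in L1_fun.
Proof.
move=> fi; rewrite (_ : (fun x => _) = (fun x => -1 * f x)) ?L1_funZ//.
by apply/funext => x; rewrite mulN1r.
Qed.

Lemma L1_fun_max f g :
  f \in L1_fun -> g \in L1_fun -> (fun x => Num.max (f x) (g x)) \in L1_fun.
Proof.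
move=> fi gi; apply: (L1_fun_le _ _ (L1_funD (L1_fun_norm fi) (L1_fun_norm gi))).
  exact: (measurable_maxr (L1_fun_measurable fi) (L1_fun_measurable gi)).
by move=> x _; rewrite maxEle; case: ifPn => _; rewrite ?lerDl ?lerDr.
Qed.

Lemma L1_fun_min f g :
  f \in L1_fun -> g \in L1_fun -> (fun x => Num.min (f x) (g x)) \in L1_fun.
Proof.
move=> fi gi; apply: (L1_fun_le _ _ (L1_funD (L1_fun_norm fi) (L1_fun_norm gi))).
  exact: (measurable_minr (L1_fun_measurable fi) (L1_fun_measurable gi)).
by move=> x _; rewrite minEle; case: ifPn => _; rewrite ?lerDl ?lerDr.
Qed.

(* Total on functions: non-integrable functions are sent to the class of 0. *)
Definition L1_class f : L1 := \pi_L1 (insubd (L1Repr L1_fun0) f).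

Lemma L1_reprP (q : L1) : (repr q : T -> R) \in L1_fun.
Proof. by case: (repr q). Qed.
Hint Resolve L1_reprP : core.

Lemma L1_class_eq f g : f \in L1_fun -> g \in L1_fun ->
  L1_class f = L1_class g <-> ae_eq mu D f g.
Proof.
have valK h : h \in L1_fun -> L1_val (insubd (L1Repr L1_fun0) h) = h.
  exact: insubdK.
move=> fi gi; rewrite -[in X in _ <-> X](valK f fi) -[in X in _ <-> X](valK g gi).
by split => [/eqquotP/asboolP|fg]//; apply/eqquotP/asboolP.
Qed.

Lemma L1_reprK (q : L1) : L1_class (repr q) = q.
Proof.
rewrite /L1_class -[RHS]reprK; congr (\pi_L1 _).
by apply: val_inj; rewrite insubdK.
Qed.

Lemma L1_classK f : f \in L1_fun -> ae_eq mu D (repr (L1_class f)) f.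
Proof. by move=> fi; apply/L1_class_eq => //; rewrite L1_reprK. Qed.

Definition L1_add (p q : L1) : L1 := L1_class (fun x => repr p x + repr q x).
Definition L1_scale (a : R) (q : L1) : L1 := L1_class (fun x => a * repr q x).
Definition L1_opp (q : L1) : L1 := L1_class (fun x => - repr q x).
Definition L1_max (p q : L1) : L1 := L1_class (fun x => Num.max (repr p x) (repr q x)).
Definition L1_min (p q : L1) : L1 := L1_class (fun x => Num.min (repr p x) (repr q x)).

Lemma L1_classD f g : f \in L1_fun -> g \in L1_fun ->
  L1_class (fun x => f x + g x) = L1_add (L1_class f) (L1_class g).
Proof.
move=> fi gi; apply/L1_class_eq; rewrite ?L1_funD//.
have fE := L1_classK fi; have gE := L1_classK gi.
by move: fE gE; apply: filterS2 => x fE gE Dx; rewrite fE// gE.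
Qed.

Lemma L1_classZ a f : f \in L1_fun ->
  L1_class (fun x => a * f x) = L1_scale a (L1_class f).
Proof.
move=> fi; apply/L1_class_eq; rewrite ?L1_funZ//.
by move: (L1_classK fi); apply: filterS => x fE Dx; rewrite fE.
Qed.

Lemma L1_classN f : f \in L1_fun ->
  L1_class (fun x => - f x) = L1_opp (L1_class f).
Proof.
move=> fi; apply/L1_class_eq; rewrite ?L1_funN//.
by move: (L1_classK fi); apply: filterS => x fE Dx; rewrite fE.
Qed.

Lemma L1_class_max f g : f \in L1_fun -> g \in L1_fun ->
  L1_class (fun x => Num.max (f x) (g x)) = L1_max (L1_class f) (L1_class g).
Proof.
move=> fi gi; apply/L1_class_eq; rewrite ?L1_fun_max//.
have fE := L1_classK fi; have gE := L1_classK gi.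
by move: fE gE; apply: filterS2 => x fE gE Dx; rewrite fE// gE.
Qed.

Lemma L1_class_min f g : f \in L1_fun -> g \in L1_fun ->
  L1_class (fun x => Num.min (f x) (g x)) = L1_min (L1_class f) (L1_class g).
Proof.
move=> fi gi; apply/L1_class_eq; rewrite ?L1_fun_min//.
have fE := L1_classK fi; have gE := L1_classK gi.
by move: fE gE; apply: filterS2 => x fE gE Dx; rewrite fE// gE.
Qed.

Lemma L1_ind (P : L1 -> Prop) :
  (forall f, f \in L1_fun -> P (L1_class f)) -> forall q, P q.
Proof. by move=> h q; rewrite -(L1_reprK q); exact: h. Qed.

Let L1_addA : associative L1_add.
Proof.
elim/L1_ind => f fi; elim/L1_ind => g gi; elim/L1_ind => h hi.
rewrite -!L1_classD ?L1_funD//; congr L1_class.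
by apply/funext => x; rewrite addrA.
Qed.

Let L1_addC : commutative L1_add.
Proof.
elim/L1_ind => f fi; elim/L1_ind => g gi.
by rewrite -!L1_classD//; congr L1_class; apply/funext => x; rewrite addrC.
Qed.

Let L1_add0 : left_id (L1_class (cst 0)) L1_add.
Proof.
elim/L1_ind => f fi.
rewrite -!L1_classD ?L1_fun0//; congr L1_class.
by apply/funext => x; rewrite add0r.
Qed.

Let L1_addN : left_inverse (L1_class (cst 0)) L1_opp L1_add.
Proof.
elim/L1_ind => f fi.
rewrite -L1_classN// -L1_classD ?L1_funN//; congr L1_class.
by apply/funext => x; rewrite addNr.
Qed.

HB.instance Definition _ := GRing.isZmodule.Build L1 L1_addA L1_addC L1_add0 L1_addN.

Let L1_scaleA a b (q : L1) : L1_scale a (L1_scale b q) = L1_scale (a * b) q.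
Proof.
elim/L1_ind: q => f fi; rewrite -!L1_classZ ?L1_funZ//.
by congr L1_class; apply/funext => x; rewrite mulrA.
Qed.

Let L1_scale1 : left_id 1 L1_scale.
Proof.
elim/L1_ind => f fi; rewrite -!L1_classZ//.
by congr L1_class; apply/funext => x; rewrite mul1r.
Qed.

Let L1_scaleDr : right_distributive L1_scale +%R.
Proof.
move=> a; elim/L1_ind => f fi; elim/L1_ind => g gi.
rewrite -[_ + _]/(L1_add _ _) -[RHS]/(L1_add _ _).
rewrite -(L1_classZ a fi) -(L1_classZ a gi) -(L1_classD fi gi).
rewrite -(L1_classZ a (L1_funD fi gi)) -(L1_classD (L1_funZ a fi) (L1_funZ a gi)).
by congr L1_class; apply/funext => x; rewrite mulrDr.
Qed.

Let L1_scaleDl (q : L1) : {morph L1_scale^~ q : a b / a + b}.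
Proof.
move=> a b; elim/L1_ind: q => f fi; rewrite -[RHS]/(L1_add _ _).
rewrite -!L1_classZ// -!L1_classD ?L1_funZ//.
by congr L1_class; apply/funext => x; rewrite mulrDl.
Qed.

HB.instance Definition _ :=
  GRing.Zmodule_isLmodule.Build R L1 L1_scaleA L1_scale1 L1_scaleDr L1_scaleDl.

Lemma L1_addE (p q : L1) : p + q = L1_add p q. Proof. by []. Qed.
Lemma L1_scaleE a (q : L1) : a *: q = L1_scale a q. Proof. by []. Qed.
Lemma L1_oppE (q : L1) : - q = L1_opp q. Proof. by []. Qed.

Definition L1_norm (q : L1) : R := fine (\int[mu]_(x in D) `|repr q x|%:E)%E.

Lemma L1_normE f : f \in L1_fun ->
  (L1_norm (L1_class f))%:E = (\int[mu]_(x in D) `|f x|%:E)%E.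
Proof.
move=> fi; have ri := L1_reprP (L1_class f).
rewrite /L1_norm fineK.
  apply: ge0_ae_eq_integral => //.
  - exact/measurable_EFinP/L1_fun_measurable/L1_fun_norm.
  - exact/measurable_EFinP/L1_fun_measurable/L1_fun_norm.
  - by move: (L1_classK fi); apply: filterS => x fE Dx; rewrite fE.
apply: integrable_fin_num => //; apply: integrable_norm; exact/L1_funP.
Qed.

Let L1_ler_normD (p q : L1) : L1_norm (p + q) <= L1_norm p + L1_norm q.
Proof.
elim/L1_ind: p => f fi; elim/L1_ind: q => g gi.
rewrite L1_addE -L1_classD//.
rewrite -lee_fin EFinD !L1_normE ?L1_funD//.
have fE := L1_fun_measurable fi; have gE := L1_fun_measurable gi.
rewrite -ge0_integralD//; last 2 first.
  exact/measurable_EFinP/L1_fun_measurable/L1_fun_norm.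
  exact/measurable_EFinP/L1_fun_measurable/L1_fun_norm.
apply: ge0_le_integral => //.
- exact/measurable_EFinP/L1_fun_measurable/L1_fun_norm/L1_funD.
- apply/(measurable_EFinP _ (fun x => `|f x| + `|g x|))/measurable_funD.
    exact/L1_fun_measurable/L1_fun_norm.
  exact/L1_fun_measurable/L1_fun_norm.
- by move=> x _; rewrite lee_fin ler_normD.
Qed.

Let L1_normZ a (q : L1) : L1_norm (a *: q) = `|a| * L1_norm q.
Proof.
elim/L1_ind: q => f fi.
rewrite L1_scaleE -L1_classZ//.
apply/EFin_inj; rewrite EFinM !L1_normE ?L1_funZ//.
rewrite -ge0_integralZl_EFin//; last first.
  exact/measurable_EFinP/L1_fun_measurable/L1_fun_norm.
by apply: eq_integral => x _; rewrite normrM EFinM.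
Qed.

Let L1_norm0_eq0 (q : L1) : L1_norm q = 0 -> q = 0.
Proof.
elim/L1_ind: q => f fi fn0; have := L1_normE fi; rewrite fn0 => /esym f0.
apply/L1_class_eq; rewrite ?L1_fun0//.
have mf := L1_fun_measurable fi.
have : ae_eq mu D (EFin \o f) (cst 0%E).
  by apply/ae_eq_integral_abs => //; exact/measurable_EFinP.
by apply: filterS => x /[apply] -[].
Qed.

HB.instance Definition _ :=
  Lmodule_isNormed.Build R L1 L1_ler_normD L1_normZ L1_norm0_eq0.


Lemma L1_class_norm f : f \in L1_fun ->
  (`|L1_class f|%:E = \int[mu]_(x in D) `|f x|%:E)%E.
Proof. exact: L1_normE. Qed.

Lemma L1_classB_norm f g : f \in L1_fun -> g \in L1_fun ->
  (`|L1_class f - L1_class g|%:E = \int[mu]_(x in D) `|f x - g x|%:E)%E.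
Proof.
move=> fi gi; rewrite -L1_class_norm ?L1_funD ?L1_funN//; congr (`|_|%:E).
by rewrite (L1_classD fi (L1_funN gi)) L1_classN.
Qed.

(** * Completeness of L^1 *)

Lemma measurable_abs_subr f g : measurable_fun D f -> measurable_fun D g ->
  measurable_fun D (fun x => `|f x - g x|%:E).
Proof.
move=> mf mg; apply/measurable_EFinP; apply: measurableT_comp => //.
exact: measurable_funB.
Qed.

(** By monotone convergence the series of the gaps has integral at most 1, so it is finite a.e.; the
    telescoping series then converges absolutely. *)
Lemma L1_fast_cauchy_ae (f : nat -> T -> R) : (forall n, f n \in L1_fun) ->
  (forall n, \int[mu]_(x in D) `|f n x - f n.+1 x|%:E <= (1 / (2 ^ n.+1)%:R)%:E)%E ->
  {ae mu, forall x, D x -> cvgn (f ^~ x)}.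
Proof.
move=> fi fle.
pose S x := (\sum_(n <oo) `|f n x - f n.+1 x|%:E)%E.
have mf n := L1_fun_measurable (fi n).
have mS : measurable_fun D S.
  apply: ge0_emeasurable_sum => //.
  by move=> n _; exact: measurable_abs_subr.
have S0 x : (0 <= S x)%E by exact: nneseries_ge0.
have Soo : mu.-integrable D S.
  apply/integrableP; split=> //.
  under eq_integral do rewrite gee0_abs//.
  rewrite integral_nneseries//; last by move=> n; exact: measurable_abs_subr.
  apply: (@le_lt_trans _ _ (1%:E)); last exact: ltry.
  apply: le_trans (epsilon_trick0 xpredT ler01).
  by apply: lee_nneseries => n *; [exact: integral_ge0|exact: fle].
have := integrable_ae mD Soo; apply: filterS => x /[apply] Sx.
have : cvgn [normed series (telescope (f ^~ x))].
  apply: nondecreasing_is_cvgn.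
    by apply: nondecreasing_series => n _ _; exact: normr_ge0.
  exists (fine (S x)) => _ [n _ <-]; rewrite /series/= /telescope.
  rewrite -lee_fin fineK// -sumEFin; under eq_bigr do rewrite distrC.
  exact: nneseries_lim_ge.
move=> /normed_cvg; rewrite telescopeK => cf.
rewrite (_ : f ^~ x = (fun n => f 0%N x + (f n x - f 0%N x))).
  by apply: is_cvgD => //; exact: is_cvg_cst.
by apply/funext => n; rewrite addrC subrK.
Qed.

(* The norm bound is Fatou's lemma for the differences with the tail. *)
Lemma L1_fast_cauchy_cvg (u : nat -> L1) :
  (forall n m, (n <= m)%N -> `|u n - u m| <= 1 / (2 ^ n.+1)%:R) ->
  exists q, forall n, `|u n - q| <= 1 / (2 ^ n.+1)%:R.
Proof.
move=> ule; pose f n : T -> R := repr (u n).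
have fi n : f n \in L1_fun by exact: L1_reprP.
have uE n : u n = L1_class (f n) by rewrite L1_reprK.
have mf n := L1_fun_measurable (fi n).
have fle n m : (n <= m)%N ->
    (\int[mu]_(x in D) `|f n x - f m x|%:E <= (1 / (2 ^ n.+1)%:R)%:E)%E.
  by move=> /ule; rewrite -lee_fin !uE L1_classB_norm.
have fcvg := L1_fast_cauchy_ae fi (fun n => fle _ _ (leqnSn n)).
(* The upper limit is measurable whether or not the sequence converges, and [fine] changes it only
   on the null set of divergence. *)
pose g x := fine (limn_esup (fun n => (f n x)%:E)).
have mg : measurable_fun D g.
  apply: measurableT_comp => //.
  by apply: measurable_fun_limn_esup => n; exact/measurable_EFinP.
have gle n : (\int[mu]_(x in D) `|f n x - g x|%:E <= (1 / (2 ^ n.+1)%:R)%:E)%E.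
  pose h m x := `|f n x - f (n + m)%N x|%:E.
  apply: (@le_trans _ _ (\int[mu]_(x in D) limn_einf (h ^~ x))%E).
    apply: ae_ge0_le_integral => //.
    - exact: measurable_abs_subr.
    - move=> x _; rewrite limn_einf_lim; apply: lime_ge; first exact: is_cvg_einfs.
      by apply: nearW => m; apply: le_ereal_inf_tmp => _ [k _ <-]; rewrite lee_fin.
    - apply: measurableT_comp; first exact: oppe_measurable.
      apply: measurable_fun_limn_esup => m.
      apply: measurableT_comp; first exact: oppe_measurable.
      exact: measurable_abs_subr.
    move: fcvg; apply: filterS => x /[apply] /cvg_ex[l fl].
    have -> : g x = l.
      have fEl : (f n0 x)%:E @[n0 --> \oo] --> l%:E.
        by apply: cvg_EFin; [exact: nearW|exact: fl].
      by rewrite /g (is_cvg_limn_esupE (cvgP _ fEl)) (cvg_lim _ fEl).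
    suff : h m x @[m --> \oo] --> `|f n x - l|%:E.
      by move=> hl; rewrite (is_cvg_limn_einfE (cvgP _ hl)) (cvg_lim _ hl).
    apply: cvg_EFin; first exact: nearW.
    apply: cvg_norm; apply: cvgB; first exact: cvg_cst.
    rewrite (_ : (fun m => f (n + m)%N x) = (fun m => f (m + n)%N x)).
      by rewrite (cvg_shiftn n (f ^~ x)).
    by apply/funext => m; rewrite addnC.
  apply: le_trans (fatou mu mD (f := h) _ _) _ => //.
    by move=> m; exact: measurable_abs_subr.
    by move=> m x _; rewrite lee_fin.
  rewrite limn_einf_lim; apply: lime_le; first exact: is_cvg_einfs.
  apply: nearW => m; apply: le_trans (fle n (n + m)%N _); last exact: leq_addr.
  by apply: ereal_inf_lbound; exists m => /=.
have gi : g \in L1_fun.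
  have h0 : (fun x => f 0%N x - g x) \in L1_fun.
    apply/L1_funP/integrableP; split.
      by apply/measurable_EFinP; exact: measurable_funB.
    by apply: le_lt_trans (gle 0%N) _; exact: ltry.
  rewrite (_ : g = (fun x => f 0%N x + - (f 0%N x - g x))).
    by apply: L1_funD => //; exact: L1_funN.
  by apply/funext => x; rewrite opprB addrC subrK.
by exists (L1_class g) => n; rewrite uE -lee_fin L1_classB_norm.
Qed.

(** Centres of balls of radius [1 / 2 ^ n.+2] that belong to [F] form a fast Cauchy sequence,
    because two members of [F] meet; the radius is half of the bound required between centres. The
    limit of the centres is the limit of the filter. *)
Let L1_complete (F : set_system L1) : ProperFilter F -> cauchy F -> cvg F.
Proof.
move=> FF /cauchyP Fc.
have e0 n : 0 < 1 / (2 ^ n.+2)%:R :> R by rewrite divr_gt0// ltr0n expn_gt0.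
have half n : 1 / (2 ^ n)%:R = 1 / (2 ^ n.+1)%:R + 1 / (2 ^ n.+1)%:R :> R.
  by rewrite expnS natrM; field; rewrite pnatr_eq0 -lt0n expn_gt0.
have /choice[u Fu] n := Fc _ (e0 n).
have [|q uq] := @L1_fast_cauchy_cvg u.
  move=> n m nm.
  have /filter_ex[y [/= yn ym]] : F (ball (u n) (1 / (2 ^ n.+2)%:R) `&`
      ball (u m) (1 / (2 ^ m.+2)%:R)) by exact: filterI.
  move: yn ym; rewrite -!ball_normE/= => yn ym.
  rewrite -(subrK y (u n)) -addrA (le_trans (ler_normD _ _))//.
  rewrite (distrC y).
  apply: (@le_trans _ _ (1 / (2 ^ n.+2)%:R + 1 / (2 ^ n.+2)%:R)).
    rewrite lerD ?(ltW yn)// (le_trans (ltW ym))//.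
    by rewrite ler_pM2l// lef_pV2 ?posrE ?ltr0n ?expn_gt0// ler_nat leq_exp2l.
  by rewrite -half.
apply/cvg_ex; exists q; apply/cvg_ballP => e e_gt0.
pose n := (Num.truncn e^-1).+1.
have ne : 1 / (2 ^ n)%:R < e.
  rewrite div1r invf_plt ?posrE ?ltr0n ?expn_gt0//.
  apply: lt_le_trans (truncnS_gt e^-1) _.
  by rewrite ler_nat ltnW// ltn_expl.
apply: filterS (Fu n) => y; rewrite -!ball_normE/= => yn.
rewrite -(subrK (u n) q) -addrA (le_lt_trans (ler_normD _ _))//.
rewrite (le_lt_trans _ ne)//.
rewrite half.
rewrite lerD ?(distrC q)// (le_trans (ltW yn))//.
by rewrite ler_pM2l// lef_pV2 ?posrE ?ltr0n ?expn_gt0// ler_nat leq_exp2l.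
Qed.

HB.instance Definition _ := Uniform_isComplete.Build L1 L1_complete.

(** * Order and lattice structure of L^1 *)

Definition L1_le (p q : L1) : bool :=
  `[< {ae mu, forall x, D x -> repr p x <= repr q x} >].

Lemma L1_leP f g : f \in L1_fun -> g \in L1_fun ->
  L1_le (L1_class f) (L1_class g) <-> {ae mu, forall x, D x -> f x <= g x}.
Proof.
move=> fi gi; have fE := L1_classK fi; have gE := L1_classK gi.
split=> [/asboolP fg|fg]; last apply/asboolP.
  by move: fE gE fg; apply: filterS3 => x fE gE fg Dx; rewrite -fE// -gE// fg.
by move: fE gE fg; apply: filterS3 => x fE gE fg Dx; rewrite fE// gE// fg.
Qed.

Let L1_le_refl : reflexive L1_le.
Proof. by move=> p; apply/asboolP/aeW. Qed.

Let L1_le_anti : antisymmetric L1_le.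
Proof.
elim/L1_ind => f fi; elim/L1_ind => g gi /andP[/(L1_leP fi gi) fg /(L1_leP gi fi) gf].
apply/L1_class_eq => //; move: fg gf; apply: filterS2 => x fg gf Dx.
by apply/eqP; rewrite eq_le fg// gf.
Qed.

Let L1_le_trans : transitive L1_le.
Proof.
move=> q p r /asboolP pq /asboolP qr; apply/asboolP.
move: pq qr; apply: filterS2 => x pq qr Dx; exact: le_trans (pq Dx) (qr Dx).
Qed.

Let L1_leUx p q r : L1_le (L1_max p q) r = L1_le p r && L1_le q r.
Proof.
elim/L1_ind: p => f fi; elim/L1_ind: q => g gi; elim/L1_ind: r => h hi.
rewrite -(L1_class_max fi gi); apply/idP/andP.
  move=> /(L1_leP (L1_fun_max fi gi) hi) H; split; apply/L1_leP => //; move: H;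
    apply: filterS => x /[apply]; rewrite ge_max => /andP[]//.
move=> [/(L1_leP fi hi) fh /(L1_leP gi hi) gh].
apply/L1_leP; rewrite ?L1_fun_max//; move: fh gh.
by apply: filterS2 => x fh gh Dx; rewrite ge_max fh// gh.
Qed.

Let L1_lexI p q r : L1_le r (L1_min p q) = L1_le r p && L1_le r q.
Proof.
elim/L1_ind: p => f fi; elim/L1_ind: q => g gi; elim/L1_ind: r => h hi.
rewrite -(L1_class_min fi gi); apply/idP/andP.
  move=> /(L1_leP hi (L1_fun_min fi gi)) H; split; apply/L1_leP => //; move: H;
    apply: filterS => x /[apply]; rewrite le_min => /andP[]//.
move=> [/(L1_leP hi fi) fh /(L1_leP hi gi) gh].
apply/L1_leP; rewrite ?L1_fun_min//; move: fh gh.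
by apply: filterS2 => x fh gh Dx; rewrite le_min fh// gh.
Qed.

Let L1_leD2r p q r : L1_le p q -> L1_le (p + r) (q + r).
Proof.
elim/L1_ind: p => f fi; elim/L1_ind: q => g gi; elim/L1_ind: r => h hi.
rewrite !L1_addE -(L1_classD fi hi) -(L1_classD gi hi) => /(L1_leP fi gi) fg.
apply/L1_leP; rewrite ?L1_funD//.
by move: fg; apply: filterS => x fg Dx; rewrite lerD2r fg.
Qed.

Let L1_leZ2l (a : R) p q : 0 <= a -> L1_le p q -> L1_le (a *: p) (a *: q).
Proof.
elim/L1_ind: p => f fi; elim/L1_ind: q => g gi a0.
rewrite !L1_scaleE -(L1_classZ a fi) -(L1_classZ a gi) => /(L1_leP fi gi) fg.
apply/L1_leP; rewrite ?L1_funZ//.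
by move: fg; apply: filterS => x fg Dx; rewrite ler_wpM2l ?fg.
Qed.

Lemma L1_max_oppE f : f \in L1_fun ->
  L1_max (L1_class f) (- L1_class f) = L1_class (fun x => `|f x|).
Proof.
move=> fi; rewrite L1_oppE -(L1_classN fi).
rewrite -(L1_class_max fi (L1_funN fi)); congr L1_class.
apply/funext => x; have [x0|x0] := leP 0 (f x).
  by rewrite max_l// ?ger0_norm// (le_trans _ x0)// oppr_le0.
by rewrite max_r ?ltr0_norm// (le_trans (ltW x0))// oppr_ge0 ltW.
Qed.

Let L1_le_norm p q : L1_le (L1_max p (- p)) (L1_max q (- q)) -> `|p| <= `|q|.
Proof.
elim/L1_ind: p => f fi; elim/L1_ind: q => g gi.
rewrite !L1_max_oppE// => /(L1_leP (L1_fun_norm fi) (L1_fun_norm gi)) fg.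
rewrite -lee_fin !L1_class_norm//; apply: ae_ge0_le_integral => //.
- exact/measurable_EFinP/L1_fun_measurable/L1_fun_norm.
- exact/measurable_EFinP/L1_fun_measurable/L1_fun_norm.
Qed.

Definition L1_lattice : banach_lattice L1 :=
  BanachLattice L1_le_refl L1_le_anti L1_le_trans L1_leUx L1_lexI
    L1_leD2r L1_leZ2l L1_le_norm.

(** Disjointness means that at almost every point one of the two representatives vanishes, so the
    triangle inequality is an equality there. *)
Lemma L1_AL_space : AL_space L1_lattice.
Proof.
move=> p q; rewrite /bl_abs /=.
elim/L1_ind: p => f fi; elim/L1_ind: q => g gi.
have fi' := L1_fun_norm fi; have gi' := L1_fun_norm gi.
rewrite !L1_max_oppE// -L1_class_min// => /L1_class_eq.
move=> /(_ (L1_fun_min fi' gi') L1_fun0) fg.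
apply/EFin_inj; rewrite EFinD.
rewrite L1_addE -(L1_classD fi gi).
rewrite !L1_class_norm ?L1_funD// -ge0_integralD//; last 2 first.
  exact/measurable_EFinP/L1_fun_measurable.
  exact/measurable_EFinP/L1_fun_measurable.
apply: ge0_ae_eq_integral => //.
- exact/measurable_EFinP/L1_fun_measurable/L1_fun_norm/L1_funD.
- exact/(measurable_EFinP _ (fun x => `|f x| + `|g x|))/L1_fun_measurable/L1_funD.
- by move=> x _; rewrite adde_ge0.
move: fg; apply: filterS => x /[apply] /= fg; congr EFin; move: fg.
have [_ /normr0P/eqP ->|_ /normr0P/eqP ->] := leP `|f x| `|g x|.
  by rewrite normr0 !add0r.
by rewrite normr0 !addr0.
Qed.

End L1_space.

(** * Rearrangements and Cesaro averages *)

Section measurability.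
Context {R : realType}.

(** Squaring makes the base nonnegative, where [powR] with exponent -1 is the inverse; at 0 both
    sides vanish since [0^-1 = 0]. *)
Lemma invr_measurable : measurable_fun [set: R] (fun x => x^-1).
Proof.
rewrite (_ : (fun x => _) = (fun x : R => x * (x ^+ 2) `^ (-1))).
  apply: measurable_funM => //.
  apply: (measurableT_comp (measurable_powR _)).
  exact: exprn_measurable.
apply/funext => x; rewrite powR_inv1 ?sqr_ge0//.
have [->|x0] := eqVneq x 0; first by rewrite invr0 mul0r.
by field.
Qed.

Lemma ereal_nonincreasing_measurable (D : set R) (f : R -> \bar R) :
  measurable D -> {in D &, {homo f : x y / x <= y >-> (y <= x)%E}} ->
  measurable_fun D f.
Proof.
move=> mD fni _; apply: (measurability _ (ErealGenCInfty.measurableE R)) => //.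
move=> /= _ [_ [y ->]] <-.
(* [D] may have gaps, so the superlevel set is written as the trace on [D] of its downward closure,
   which is an interval. *)
have -> : D `&` f @^-1` `[y%:E, +oo[ =
    D `&` [set s | exists u, [/\ D u, s <= u & (y%:E <= f u)%E]].
  apply/seteqP; split=> x [Dx]/=; rewrite in_itv/= andbT.
    by move=> yfx; split => //; exists x.
  move=> [u [Du xu yu]]; split => //.
  by apply: le_trans yu _; apply: fni; rewrite ?inE.
apply: measurableI => //; apply: is_interval_measurable.
move=> a b _ [u [Du bu yu]] c /andP[ac cb]; exists u; split => //.
exact: le_trans bu.
Qed.

Lemma ereal_nondecreasing_measurable (D : set R) (f : R -> \bar R) :
  measurable D -> {in D &, {homo f : x y / x <= y >-> (x <= y)%E}} ->
  measurable_fun D f.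
Proof.
move=> mD fnd; rewrite (_ : f = (-%E \o (-%E \o f)))%E; last first.
  by apply/funext => x /=; rewrite oppeK.
apply: measurableT_comp; first exact: oppe_measurable.
apply: ereal_nonincreasing_measurable => // x y xD yD xy /=.
by rewrite leeN2 fnd.
Qed.

End measurability.

Section rearrangement_theory.
Context {R : realType}.
Local Open Scope ereal_scope.
Local Notation lambda := (@lebesgue_measure R).
Local Notation I01 := (`[0%R, 1%R]%classic : set R).
Implicit Types (h : R -> \bar R) (s : R).

Lemma rearrangement_ge0 h s : 0 <= rearrangement h s.
Proof. by apply: le_ereal_inf_tmp => _ [t [t0 _] <-]; rewrite lee_fin. Qed.

Lemma rearrangement_le h s (t : \bar R) : 0 <= t ->
  lambda (I01 `&` [set x | t < `|h x|]) <= s%:E -> rearrangement h s <= t.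
Proof.
case: t => [t|_ _|//]; last by rewrite leey.
rewrite lee_fin => t0 hs; apply: ereal_inf_lbound; exists t => //.
Qed.

Lemma measurable_superlevel h (t : \bar R) : measurable_fun I01 h ->
  measurable (I01 `&` [set x | t < `|h x|]).
Proof.
move=> mh; apply: emeasurable_fun_o_infty => //.
exact: measurableT_comp.
Qed.

Lemma rearrangement_ge h s (c : \bar R) (A : set R) : measurable_fun I01 h ->
  measurable A -> A `<=` I01 -> s%:E < lambda A ->
  (forall x, A x -> c <= `|h x|) -> c <= rearrangement h s.
Proof.
move=> mh mA A01 sA cA; apply: le_ereal_inf_tmp => _ [t [t0 ht] <-].
rewrite leNgt; apply/negP => tc.
have : lambda A <= s%:E; last by rewrite leNgt sA.
apply: le_trans ht; apply: le_measure; rewrite ?inE//.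
  exact: measurable_superlevel.
by move=> x Ax; split; [exact: A01|exact: lt_le_trans (cA _ Ax)].
Qed.

Lemma rearrangement_nonincreasing h :
  {homo rearrangement h : s t / (s <= t)%R >-> t <= s}.
Proof.
move=> s t st; apply: ereal_inf_le_tmp => _ [u [u0 hu] <-].
by exists u => //; split => //; rewrite (le_trans hu).
Qed.

Lemma measurable_rearrangement h (D : set R) : measurable D ->
  measurable_fun D (rearrangement h).
Proof.
move=> mD; apply: ereal_nonincreasing_measurable => // x y _ _.
exact: rearrangement_nonincreasing.
Qed.

End rearrangement_theory.

Section cesaro_theory.
Context {R : realType}.
Local Open Scope ereal_scope.
Local Notation lambda := (@lebesgue_measure R).
Local Notation I01 := (`[0%R, 1%R]%classic : set R).
Implicit Types f : R -> R.

Local Notation C f := (cesaro_op (fun x => `|f x|%R)).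

Lemma primitive_le f (x y : R) : measurable_fun I01 f -> (x <= y)%R -> (y <= 1)%R ->
  \int[lambda]_(t in `[0%R, x]) `|f t|%:E <= \int[lambda]_(t in `[0%R, y]) `|f t|%:E.
Proof.
move=> mf xy y1; apply: ge0_subset_integral => //.
  apply/measurable_EFinP; apply: measurableT_comp => //.
  by apply: measurable_funS mf => //; exact: subset_itvl.
exact: subset_itvl.
Qed.

Lemma cesaro_ge0 f x : (0 <= x)%R -> 0 <= C f x.
Proof.
by move=> x0; rewrite mule_ge0 ?lee_fin ?invr_ge0// integral_ge0.
Qed.

(** The primitive is monotone, hence measurable even where it is infinite. *)
Lemma cesaro_measurable f : measurable_fun I01 f -> measurable_fun I01 (C f).
Proof.
move=> mf; apply: emeasurable_funM.
  by apply/measurable_EFinP; apply: measurable_funTS; exact: invr_measurable.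
apply: ereal_nondecreasing_measurable => // x y _.
by rewrite inE/= in_itv/= => /andP[_ y1] xy; exact: primitive_le.
Qed.

End cesaro_theory.

(** * Dilation indices and the Stieltjes measure *)

Section dilation.
Context {R : realType}.
Variable phi : R -> R.
Hypothesis phi_ge0 : {in `[0, 1], forall x, 0 <= phi x}.
Hypothesis phi_nd : {in `[0, 1] &, {homo phi : x y / x <= y}}.
Hypothesis phi_concave : @convex_function R R^o `[0, 1] (fun x => - phi x).
Hypothesis phi0 : phi 0 = 0.

Lemma in01 (x : R) : 0 <= x -> x <= 1 -> x \in `[0, 1].
Proof. by move=> x0 x1; rewrite in_itv/= x0. Qed.

Lemma le_phi (x y : R) : 0 <= x -> x <= y -> y <= 1 -> phi x <= phi y.
Proof.
by move=> x0 xy y1; apply: phi_nd => //; apply: in01 => //; lra.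
Qed.

(** This is the monotonicity of phi(x) / x, cleared of denominators: [s] is the convex combination
    of [t] and 0 with weight [s / t]. *)
Lemma concave_star_shaped (s t : R) : 0 <= s -> s <= t -> t <= 1 ->
  s * phi t <= t * phi s.
Proof.
move=> s0 st t1; have [t0|t0] := leP t 0.
  have -> : t = 0 by lra.
  have -> : s = 0 by lra.
  by [].
have k0 : 0 <= s / t by rewrite divr_ge0// ltW.
have k1 : s / t <= 1 by rewrite ler_pdivrMr// mul1r.
have := phi_concave (Itv01 k0 k1) (_ : t \in `[0, 1]%classic) (_ : 0 \in `[0, 1]%classic).
rewrite !inE/= => /(_ (in01 (ltW t0) t1) (in01 (lexx 0) ler01)).
rewrite convRE/= phi0 oppr0 mulr0 addr0.
rewrite [X in phi X](_ : _ = s); last first.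
  by rewrite [LHS]convRE/= mulr0 addr0 divfK ?gt_eqF.
rewrite mulrN lerN2 mulrAC ler_pdivrMr// mulrC (mulrC (phi s)).
by rewrite mulrC (mulrC t).
Qed.

Lemma phi_gt0 (s : R) : 0 < phi 1 -> 0 < s -> s <= 1 -> 0 < phi s.
Proof.
move=> p1 s0 s1; have := concave_star_shaped (ltW s0) s1 (lexx 1).
by rewrite mul1r; apply: lt_le_trans; rewrite mulr_gt0.
Qed.

Lemma lower_dilation_index_gt0P : 0 < lower_dilation_index phi ->
  0 < phi 1 /\ exists t m : R, [/\ 0 < t < 1, 0 < m < 1 &
    forall s, 0 < s -> s <= 1 -> phi (s * t) <= m * phi s].
Proof.
move=> g0.
(* A divergent [lim] takes the default value 0, so a positive index proves that the limit exists. *)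
have c : cvg (ln (sup [set phi (s * t) / phi s | s in `]0, 1]]) / ln t @[t --> 0^'+]).
  by apply: cvgNpoint; rewrite -/(lower_dilation_index phi) gt_eqF.
have gt0 : \forall t \near 0^'+,
    0 < ln (sup [set phi (s * t) / phi s | s in `]0, 1]]) / ln t.
  exact: cvgr_gt c _ g0.
near (0 : R)^'+ => t.
have t0 : 0 < t by near: t; exact: nbhs_right_gt.
have t1 : t < 1 by near: t; exact: nbhs_right_lt.
have : 0 < ln (sup [set phi (s * t) / phi s | s in `]0, 1]]) / ln t by near: t.
set m := sup _ => mt.
have lnm : ln m < 0.
  by move: mt; rewrite nmulr_lgt0// invr_lt0 ln_lt0// t0.
(* [ln] is 0 on nonpositive reals, so a negative logarithm forces a positive argument. *)
have m0 : 0 < m by rewrite ltNge; apply/negP => m0; move: lnm; rewrite ln0 ?ltxx.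
have m1 : m < 1 by rewrite ltNge; apply/negP => /ln_ge0; rewrite leNgt lnm.
have st1 (s : R) : 0 < s -> s <= 1 -> s * t <= s.
  by move=> s0 s1; rewrite ger_pMr// ltW.
have hub : has_ubound [set phi (s * t) / phi s | s in `]0, 1]].
  exists 1 => _ [s /= + <-]; rewrite in_itv/= => /andP[s0 s1].
  have ps0 := phi_ge0 (in01 (ltW s0) s1).
  have [->|ps] := eqVneq (phi s) 0; first by rewrite invr0 mulr0.
  rewrite ler_pdivrMr ?lt_neqAle 1?eq_sym ?ps// mul1r.
  by apply: le_phi => //; [rewrite mulr_ge0// ltW|exact: st1].
have le_m (s : R) : 0 < s -> s <= 1 -> phi (s * t) / phi s <= m.
  by move=> s0 s1; apply: ub_le_sup => //; exists s => //=; rewrite in_itv/= s0.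
(* If [phi 1] were 0, [phi] would vanish on the whole interval and every quotient would be 0 by the
   convention on [0^-1]. *)
have p1 : 0 < phi 1.
  rewrite lt_neqAle eq_sym phi_ge0 ?in01// andbT; apply/negP => /eqP p1.
  have : m <= 0; last by rewrite leNgt m0.
  apply: ge_sup.
    by exists (phi (1 * t) / phi 1), 1 => //=; rewrite in_itv/= ltr01 lexx.
  move=> _ [s /= + <-]; rewrite in_itv/= => /andP[s0 s1].
  have -> : phi s = 0.
    by apply/eqP; rewrite eq_le phi_ge0 ?in01 ?(ltW s0)// andbT -p1 le_phi// ltW.
  by rewrite invr0 mulr0.
split => //; exists t, m; split; rewrite ?t0 ?m0//.
by move=> s s0 s1; rewrite -ler_pdivrMr ?le_m// phi_gt0.
Unshelve. all: by end_near. Qed.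

(** A limit below 1 puts the supremum strictly below [t] for some large [t]; [q] is their ratio.
    Positivity of the index rules out the default value 0 of a divergent [lim]. *)
Lemma upper_dilation_index_lt1P : 0 < phi 1 -> 0 < upper_dilation_index phi < 1 ->
  exists t q : R, [/\ 1 < t, 0 < q < 1 &
    forall s, 0 < s -> s * t <= 1 -> phi (s * t) <= q * t * phi s].
Proof.
move=> p1 /andP[d0 d1].
have c : cvg (ln (sup [set phi (s * t) / phi s | s in `]0, t^-1]]) / ln t @[t --> +oo]).
  by apply: cvgNpoint; rewrite -/(upper_dilation_index phi) gt_eqF.
have lt1 : \forall t \near +oo,
    ln (sup [set phi (s * t) / phi s | s in `]0, t^-1]]) / ln t < 1.
  exact: cvgr_lt c _ d1.
near (+oo_R) => t.
have t1 : 1 < t by near: t; apply: nbhs_pinfty_gt; rewrite num_real.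
have t0 : 0 < t by rewrite (lt_trans _ t1).
have : ln (sup [set phi (s * t) / phi s | s in `]0, t^-1]]) / ln t < 1 by near: t.
set m := sup _ => mt.
have lnm : ln m < ln t by move: mt; rewrite ltr_pdivrMr ?mul1r// ln_gt0.
have stle1 (s : R) : s <= t^-1 -> s * t <= 1 by rewrite -ler_pdivlMr// div1r.
have sle1 (s : R) : s <= t^-1 -> s <= 1.
  by move=> st; rewrite (le_trans st)// invf_le1// ltW.
have pst (s : R) : 0 < s -> s <= t^-1 -> 0 < phi (s * t).
  by move=> s0 st; rewrite (phi_gt0 p1) ?mulr_gt0// stle1.
have hub : has_ubound [set phi (s * t) / phi s | s in `]0, t^-1]].
  exists t => _ [s /= + <-]; rewrite in_itv/= => /andP[s0 st].
  rewrite ler_pdivrMr ?(phi_gt0 p1) ?sle1// -(ler_pM2l s0) mulrA.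
  by apply: concave_star_shaped; rewrite ?stle1 ?(ltW s0)// ler_peMr// ltW.
have le_m (s : R) : 0 < s -> s <= t^-1 -> phi (s * t) / phi s <= m.
  by move=> s0 s1; apply: ub_le_sup => //; exists s => //=; rewrite in_itv/= s0.
have m0 : 0 < m.
  have tV0 : 0 < t^-1 by rewrite invr_gt0.
  apply: lt_le_trans (le_m _ tV0 (lexx _)).
  by rewrite divr_gt0 ?pst// (phi_gt0 p1)// sle1.
have mltt : m < t by rewrite -ltr_ln ?posrE.
exists t, (m / t); split => //; first by rewrite divr_gt0//= ltr_pdivrMr// mul1r.
move=> s s0 st; rewrite divfK ?gt_eqF// -ler_pdivrMr; last first.
  by rewrite (phi_gt0 p1)// sle1// -div1r ler_pdivlMr.
by rewrite le_m// -div1r ler_pdivlMr.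
Unshelve. all: by end_near. Qed.

(** Concavity permits a jump at 0; the decay [phi (t ^+ n) <= m ^+ n * phi 1] excludes it. At
    [x > 0], [phi y] is squeezed between [phi x] and [y * (phi x / x)]. Right continuity identifies
    [stieltjes_cdf phi] with [phi] on the unit interval. *)
Lemma phi_right_continuous : 0 < lower_dilation_index phi ->
  {in `[0, 1[, forall x, phi y @[y --> x^'+] --> phi x}.
Proof.
move=> g0 x; rewrite in_itv/= => /andP[]; rewrite le_eqVlt => /predU1P[<- _|x0 x1].
  have [p1 [t [m [/andP[t0 t1] /andP[m0 m1] pm]]]] := lower_dilation_index_gt0P g0.
  have pn n : phi (t ^+ n) <= m ^+ n * phi 1.
    elim: n => [|n ih]; first by rewrite !expr0 mul1r.
    rewrite exprSr (le_trans (pm _ _ _)) ?exprn_gt0 ?exprn_ile1 ?(ltW t0) ?(ltW t1)//.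
    by rewrite exprS -mulrA ler_pM2l.
  rewrite phi0; apply/cvgrPdist_le => e e0.
  have : m ^+ n * phi 1 @[n --> \oo] --> 0 * phi 1.
    by apply: cvgMl; apply: cvg_expr; rewrite gtr0_norm.
  rewrite mul0r => /cvgrPdist_le/(_ _ e0)[n _ /(_ n (leqnn n))].
  rewrite sub0r normrN ger0_norm ?mulr_ge0 ?exprn_ge0 ?(ltW m0) ?(ltW p1)// => mne.
  near=> y.
  have y0 : 0 < y by near: y; exact: nbhs_right_gt.
  have yt : y < t ^+ n by near: y; apply: nbhs_right_lt; rewrite exprn_gt0.
  have tn1 : t ^+ n <= 1 by rewrite exprn_ile1 ?ltW.
  rewrite sub0r normrN ger0_norm; last first.
    by rewrite phi_ge0// in01 ?(ltW y0)// (le_trans (ltW yt)).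
  by rewrite (le_trans _ mne)// (le_trans _ (pn n))// le_phi// ltW.
have : y * (phi x / x) @[y --> x^'+] --> x * (phi x / x).
  by apply: cvgMl; exact: cvg_at_right_filter.
rewrite (_ : x * (phi x / x) = phi x) => [h|]; last by field; rewrite gt_eqF.
apply: (squeeze_cvgr _ (cvg_cst (phi x)) h); near=> y.
have xy : x < y by near: y; exact: nbhs_right_gt.
have y1 : y < 1 by near: y; exact: nbhs_right_lt.
have [x0' xy'] := (ltW x0, ltW xy).
apply/andP; split; first by rewrite le_phi// ltW.
by rewrite mulrA ler_pdivlMr// mulrC concave_star_shaped// ltW.
Unshelve. all: by end_near. Qed.

End dilation.

Section stieltjes_measure.
Context {R : realType}.
Variable phi : R -> R.
Hypothesis phi_ge0 : {in `[0, 1], forall x, 0 <= phi x}.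
Hypothesis phi_nd : {in `[0, 1] &, {homo phi : x y / x <= y}}.
Hypothesis phi_rc : {in `[0, 1[, forall x, phi y @[y --> x^'+] --> phi x}.
Hypothesis phi0 : phi 0 = 0.

Lemma stieltjes_itv_oc (f : cumulative R R) (a b : R) : a <= b ->
  lebesgue_stieltjes_measure f `]a, b] = (f b - f a)%:E.
Proof.
move=> ab; rewrite /lebesgue_stieltjes_measure /measure_extension.
by rewrite measurable_mu_extE/=; [rewrite wlength_itv_bnd|exact: is_ocitv].
Qed.

Local Notation mu := (lebesgue_stieltjes_measure (stieltjes_cdf phi)).

Lemma stieltjes_phi_itv_oc (a b : R) : 0 <= a -> a <= b -> b <= 1 ->
  mu `]a, b] = (phi b - phi a)%:E.
Proof.
move=> a0 ab b1; rewrite stieltjes_itv_oc//.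
have b0 := le_trans a0 ab; have a1 := le_trans ab b1.
by congr (_ - _)%:E; apply: stieltjes_cdfE => //; exact: in01.
Qed.

(** The Lorentz norm integrates over a closed interval; the absence of an atom at 0 discards the
    value of the rearrangement at 0, which may be infinite. *)
Lemma stieltjes_phi_set1 : mu [set 0] = 0%E.
Proof.
have cdf0 : stieltjes_cdf phi 0 = 0.
  by rewrite -[RHS]phi0; apply: stieltjes_cdfE => //; exact: in01.
apply/eqP; rewrite eq_le measure_ge0 andbT.
apply: (@le_trans _ _ (mu `]-1, 0])).
  apply: le_measure; rewrite ?inE//= => x ->.
  by rewrite /= in_itv/= lexx andbT ltrN10.
rewrite stieltjes_itv_oc ?lerN10// lee_fin subr_le0.
apply: (@le_trans _ _ 0); first by rewrite -[leRHS]cdf0.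
apply: lb_le_inf.
  exists (Num.max 0 (phi (Num.max 0 (Num.min 1 0)))), 0 => //=.
  by rewrite in_itv/= andbT ltrN10.
by move=> _ [y _ <-]; rewrite le_max lexx.
Qed.

End stieltjes_measure.

(** * Lorentz spaces *)

Section tonelli.
Context d1 d2 (T1 : measurableType d1) (T2 : measurableType d2) (R : realType).
Variables (m1 : {sigma_finite_measure set T1 -> \bar R})
          (m2 : {sigma_finite_measure set T2 -> \bar R}).
Variables (D1 : set T1) (D2 : set T2).
Hypotheses (mD1 : measurable D1) (mD2 : measurable D2).
Local Open Scope ereal_scope.
Variable k : T1 * T2 -> R.
Hypothesis mk : measurable_fun setT k.
Hypothesis k0 : forall s t, D1 s -> D2 t -> (0 <= k (s, t))%R.

Section integrand.
Variable g : T2 -> \bar R.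
Hypothesis mg : measurable_fun D2 g.
Hypothesis g0 : forall t, D2 t -> 0 <= g t.

(** Tonelli's theorem is applied on the full product space, hence the extension by 0 of an integrand
    controlled only on the product of [D1] and [D2]. *)
Let F : T1 * T2 -> \bar R := (fun z => (k z)%:E * g z.2) \_ (D1 `*` D2).

Let mF : measurable_fun setT F.
Proof.
apply/measurable_restrict => //; first exact: measurableX.
rewrite setTI; apply: emeasurable_funM.
  by apply/measurable_EFinP; exact: measurable_funS mk.
apply: (measurable_comp mD2) mg _; first by move=> _ [[s t] [/= _ Dt] <-].
exact: measurable_funTS.
Qed.

Let F0 z : 0 <= F z.
Proof.
rewrite /F patchE; case: ifPn => // /set_mem[D1z D2z].
by rewrite mule_ge0 ?g0// lee_fin; case: z D1z D2z => ? ? /=; exact: k0.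
Qed.

Let FE s t : F (s, t) = if s \in D1 then
    (if t \in D2 then (k (s, t))%:E * g t else 0) else 0.
Proof. by rewrite /F patchE in_setX/=; case: (s \in D1); case: (t \in D2). Qed.

Let intFE s : s \in D1 ->
  \int[m2]_t F (s, t) = \int[m2]_(t in D2) ((k (s, t))%:E * g t).
Proof.
move=> sD; rewrite [RHS]integral_mkcond; apply: eq_integral => t _.
by rewrite FE sD patchE.
Qed.

Lemma measurable_integral_kernel :
  measurable_fun D1 (fun s => \int[m2]_(t in D2) ((k (s, t))%:E * g t)).
Proof.
have := measurable_fun_fubini_tonelli_F (m2 := m2) F mF F0.
move=> /(measurable_funS measurableT (@subsetT _ D1)).
by apply: eq_measurable_fun => s sD; rewrite /fubini_F intFE.
Qed.

Lemma tonelli_kernel :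
  \int[m1]_(s in D1) \int[m2]_(t in D2) ((k (s, t))%:E * g t) =
  \int[m2]_(t in D2) ((\int[m1]_(s in D1) (k (s, t))%:E) * g t).
Proof.
transitivity (\int[m1]_s \int[m2]_t F (s, t)).
  rewrite integral_mkcond; apply: eq_integral => s _; rewrite patchE.
  case: ifPn => sD; last first.
    by rewrite integral0_eq// => t _; rewrite FE (negbTE sD).
  by rewrite intFE.
rewrite fubini_tonelli// [RHS]integral_mkcond; apply: eq_integral => t _.
rewrite patchE; case: ifPn => tD; last first.
  by rewrite integral0_eq// => s _; rewrite FE (negbTE tD) if_same.
rewrite -ge0_integralZr//; last 3 first.
- by apply/measurable_EFinP; apply: measurable_funTS; exact: measurableT_comp.
- by move=> s D1s; rewrite lee_fin k0//; exact: set_mem.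
- by apply: g0; exact: set_mem.
by rewrite [RHS]integral_mkcond; apply: eq_integral => s _; rewrite FE tD patchE.
Qed.

End integrand.

Lemma measurable_kernel_integral :
  measurable_fun D2 (fun t => \int[m1]_(s in D1) (k (s, t))%:E).
Proof.
pose F := (fun z : T1 * T2 => (k z)%:E) \_ (D1 `*` D2).
have mF : measurable_fun setT F.
  apply/measurable_restrict => //; first exact: measurableX.
  by rewrite setTI; apply/measurable_EFinP; exact: measurable_funS mk.
have F0 z : 0 <= F z.
  rewrite /F patchE; case: ifPn => // /set_mem[D1z D2z].
  by rewrite lee_fin; case: z D1z D2z => ? ? /=; exact: k0.
have := measurable_fun_fubini_tonelli_G (m1 := m1) F mF F0.
move=> /(measurable_funS measurableT (@subsetT _ D2)).
apply: eq_measurable_fun => t tD; rewrite /fubini_G [RHS]integral_mkcond.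
apply: eq_integral => s _; rewrite /F !patchE in_setX/= tD andbT.
by case: ifP.
Qed.

End tonelli.

(** * Kernels bounding the rearrangement of a Cesaro average *)

Section kernels.
Context {R : realType}.
Local Notation I01 := (`[0%R, 1%R]%classic : set R).

(* With F the primitive of |f|, integrating |f| against the first kernel gives
   F s / s and integrating it against the second one gives F (1 - 2 s). *)
Definition near0_kernel (z : R * R) : R :=
  if (z.2 <= z.1) && (z.1 <= 3^-1) then z.1^-1 else 0.

Definition near1_kernel (z : R * R) : R := if z.2 + 2 * z.1 <= 1 then 1 else 0.

Definition lower_kernel z := near0_kernel z + near1_kernel z.

(** Twice this kernel dominates 1 / x for t <= x and s / 2 <= x <= 1 - s / 2. If t <= 1/2, then x is
    at least t and s / 2, hence at least half of the maximum of s and t. If t > 1/2, then 1 / x < 2,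
    and t <= x leaves only t <= 1 - s / 2. *)
Definition upper_kernel (z : R * R) : R :=
  if z.2 <= 2^-1 then (Num.max z.1 z.2)^-1
  else if z.2 + z.1 / 2 <= 1 then 1 else 0.

Lemma near0_kernel_ge0 s t : 0 <= s -> 0 <= near0_kernel (s, t).
Proof. by move=> s0; rewrite /near0_kernel/=; case: ifP; rewrite // invr_ge0. Qed.

Lemma near1_kernel_ge0 z : 0 <= near1_kernel z.
Proof. by rewrite /near1_kernel; case: ifP. Qed.

Lemma lower_kernel_ge0 s t : 0 <= s -> 0 <= lower_kernel (s, t).
Proof. by move=> s0; rewrite addr_ge0 ?near0_kernel_ge0 ?near1_kernel_ge0. Qed.

Lemma upper_kernel_ge0 s t : 0 <= s -> 0 <= upper_kernel (s, t).
Proof.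
move=> s0; rewrite /upper_kernel/=; case: ifP => _; last by case: ifP.
by rewrite invr_ge0 le_max s0.
Qed.

Lemma measurable_near0_kernel : measurable_fun setT near0_kernel.
Proof.
apply: measurable_fun_ifT => //.
  by apply: measurable_and; apply: measurable_fun_ler.
exact: (measurableT_comp invr_measurable).
Qed.

Lemma measurable_near1_kernel : measurable_fun setT near1_kernel.
Proof.
apply: measurable_fun_ifT => //; apply: measurable_fun_ler => //.
by apply: measurable_funD => //; apply: measurable_funM.
Qed.

Lemma measurable_lower_kernel : measurable_fun setT lower_kernel.
Proof.
exact: measurable_funD measurable_near0_kernel measurable_near1_kernel.
Qed.

Lemma measurable_upper_kernel : measurable_fun setT upper_kernel.
Proof.
apply: measurable_fun_ifT; first exact: measurable_fun_ler.
  by apply: (measurableT_comp invr_measurable); exact: measurable_maxr.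
apply: measurable_fun_ifT => //; apply: measurable_fun_ler => //.
by apply: measurable_funD => //; apply: measurable_funM.
Qed.

End kernels.

Section pointwise_bounds.
Context {R : realType}.
Local Open Scope ereal_scope.
Local Notation lambda := (@lebesgue_measure R).
Local Notation I01 := (`[0%R, 1%R]%classic : set R).
Local Notation C f := (cesaro_op (fun x => `|f x|%R)).
Variable f : R -> R.
Hypothesis mf : measurable_fun I01 f.

Lemma measurable_kernel_abs (k : R * R -> R) s : measurable_fun setT k ->
  measurable_fun I01 (fun t => (k (s, t))%:E * `|f t|%:E).
Proof.
move=> mk; apply: emeasurable_funM; apply/measurable_EFinP.
  by apply: measurable_funTS; apply: measurableT_comp => //; exact: pair1_measurable.
exact: measurableT_comp.
Qed.

Lemma integral_below (g : R -> \bar R) x : (0 <= x <= 1)%R ->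
  \int[lambda]_(t in I01) (if (t <= x)%R then g t else 0) =
  \int[lambda]_(t in `[0%R, x]) g t.
Proof.
move=> /andP[x0 x1].
have -> : `[0%R, x]%classic = I01 `&` [set t | (t <= x)%R].
  apply/seteqP; split=> t /=; rewrite !in_itv/=.
    by move=> /andP[-> tx]; split => //; exact: le_trans x1.
  by move=> [/andP[-> _] ->].
rewrite integral_mkcondr; apply: eq_integral => t _.
by rewrite patchE mem_setE.
Qed.

Lemma cesaro_near0 s : (0 < s)%R -> (3 * s <= 1)%R ->
  s^-1%:E * \int[lambda]_(t in `[0%R, s]) `|f t|%:E <= 3%:E * rearrangement (C f) s.
Proof.
move=> s0 s1; set F := \int[lambda]_(t in `[0%R, s]) _.
have -> : s^-1%:E * F = 3%:E * ((3 * s)^-1%:E * F).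
  by rewrite muleA -EFinM; congr (_%:E * _); field; rewrite gt_eqF.
rewrite lee_pmul2l//.
apply: (@rearrangement_ge _ _ _ _ `]s, (3 * s)%R]) => //.
- exact: cesaro_measurable.
- move=> x /=; rewrite !in_itv/= => /andP[sx xs].
  by apply/andP; split; [lra|exact: le_trans s1].
- rewrite lebesgue_measure_itv/= lte_fin ifT; last by lra.
  by rewrite lte_fin; lra.
move=> x /=; rewrite !in_itv/= => /andP[sx xs].
have x0 : (0 < x)%R by lra.
rewrite gee0_abs; last by apply: cesaro_ge0; exact: ltW.
apply: lee_pmul; rewrite ?lee_fin ?invr_ge0 ?integral_ge0//; first lra.
  by rewrite lef_pV2// posrE; lra.
by apply: primitive_le => //; lra.
Qed.

Lemma cesaro_near1 s : (0 < s)%R -> (2 * s <= 1)%R ->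
  \int[lambda]_(t in `[0%R, (1 - 2 * s)%R]) `|f t|%:E <= rearrangement (C f) s.
Proof.
move=> s0 s1; apply: (@rearrangement_ge _ _ _ _ `](1 - 2 * s)%R, 1%R]) => //.
- exact: cesaro_measurable.
- move=> x /=; rewrite !in_itv/= => /andP[sx xs].
  by apply/andP; split; lra.
- rewrite lebesgue_measure_itv/= lte_fin ifT; last by lra.
  by rewrite lte_fin; lra.
move=> x /=; rewrite !in_itv/= => /andP[sx x1].
have x0 : (0 < x)%R by lra.
rewrite gee0_abs; last by apply: cesaro_ge0; exact: ltW.
rewrite -[leLHS]mul1e; apply: lee_pmul; rewrite ?lee_fin ?integral_ge0//.
  by rewrite invf_ge1.
by apply: primitive_le => //; lra.
Qed.

Lemma lower_kernel_le_rearrangement s : (0 < s <= 1)%R ->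
  \int[lambda]_(t in I01) ((lower_kernel (s, t))%:E * `|f t|%:E) <=
  4%:E * rearrangement (C f) s.
Proof.
move=> /andP[s0 s1].
under eq_integral do rewrite EFinD muleDl//.
rewrite ge0_integralD//; last 4 first.
- by move=> t _; rewrite mule_ge0// lee_fin near0_kernel_ge0// ltW.
- by apply: measurable_kernel_abs; exact: measurable_near0_kernel.
- by move=> t _; rewrite mule_ge0// lee_fin near1_kernel_ge0.
- by apply: measurable_kernel_abs; exact: measurable_near1_kernel.
(* The 3 is the loss on the interval near 0; near 1 nothing is lost, because 1 / x >= 1. *)
have -> : 4%:E = 3%:E + 1%:E :> \bar R by rewrite -EFinD; congr EFin; lra.
rewrite ge0_muleDl//; apply: leeD.
  have [s3|s3] := leP (3 * s)%R 1%R; last first.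
    rewrite integral0_eq ?mule_ge0 ?rearrangement_ge0// => t _.
    rewrite /near0_kernel/= ifF ?mul0e//.
    by apply/negbTE/negP => /andP[_]; lra.
  apply: le_trans (cesaro_near0 s0 s3).
  rewrite -ge0_integralZl_EFin//; last 2 first.
  - apply/measurable_EFinP; apply: measurableT_comp => //.
    by apply: measurable_funS mf => //; exact: subset_itvl.
  - by rewrite invr_ge0 ltW.
  rewrite -(integral_below _ (x := s)) ?(ltW s0)//.
  rewrite le_eqVlt; apply/orP; left; apply/eqP; apply: eq_integral => t _.
  rewrite /near0_kernel/=; have -> : (s <= 3^-1)%R by lra.
  by rewrite andbT; case: ifP; rewrite ?mul0e.
have [s2|s2] := leP (2 * s)%R 1%R; last first.
  rewrite mul1e integral0_eq ?rearrangement_ge0// => t /=.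
  rewrite in_itv/= => /andP[t0 t1]; rewrite /near1_kernel/= ifF ?mul0e//.
  by apply/negbTE; rewrite -ltNge; lra.
rewrite mul1e; apply: le_trans (cesaro_near1 s0 s2).
rewrite -(integral_below _ (x := (1 - 2 * s)%R)); last by apply/andP; split; lra.
rewrite le_eqVlt; apply/orP; left; apply/eqP; apply: eq_integral => t _.
rewrite /near1_kernel/= lerBrDr.
by case: ifP; rewrite ?mul0e ?mul1e.
Qed.

Lemma rearrangement_le_upper_kernel s : (0 < s <= 1)%R ->
  rearrangement (C f) s <=
  \int[lambda]_(t in I01) ((2 * upper_kernel (s, t))%:E * `|f t|%:E).
Proof.
move=> /andP[s0 s1].
set J := \int[lambda]_(t in I01) _.
have J0 : 0 <= J.
  apply: integral_ge0 => t _; rewrite mule_ge0// lee_fin.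
  by rewrite mulr_ge0// upper_kernel_ge0// ltW.
apply: rearrangement_le => //.
have CJ x : (s / 2 <= x <= 1 - s / 2)%R -> C f x <= J.
  move=> /andP[sx xs]; have x0 : (0 < x)%R by lra.
  rewrite /cesaro_op -ge0_integralZl_EFin//; last 2 first.
  - apply/measurable_EFinP; apply: measurableT_comp => //.
    by apply: measurable_funS mf => //; apply: subset_itvl; rewrite bnd_simp; lra.
  - by rewrite invr_ge0 ltW.
  have m2 : measurable_fun setT (fun z : R * R => 2 * upper_kernel z)%R.
    by apply: measurable_funM => //; exact: measurable_upper_kernel.
  have mJ := measurable_kernel_abs s m2.
  have x01 : `[0%R, x]%classic `<=` I01 by apply: subset_itvl; rewrite bnd_simp; lra.
  have k0 t : 0 <= (2 * upper_kernel (s, t))%:E * `|f t|%:E.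
    by rewrite mule_ge0// lee_fin mulr_ge0// upper_kernel_ge0// ltW.
  apply: (@le_trans _ _ (\int[lambda]_(t in `[0%R, x])
      ((2 * upper_kernel (s, t))%:E * `|f t|%:E))); last first.
    by apply: ge0_subset_integral.
  apply: ge0_le_integral => //.
  - by move=> t _; rewrite mule_ge0// lee_fin invr_ge0 ltW.
  - apply: emeasurable_funM => //; apply/measurable_EFinP.
    by apply: measurableT_comp => //; exact: measurable_funS mf.
  - exact: measurable_funS mJ.
  move=> t /=; rewrite in_itv/= => /andP[t0 tx].
  apply: lee_wpmul2r => //; rewrite lee_fin /upper_kernel/=.
  case: ifP => t2.
    rewrite -(invrK 2%R) -invfM lef_pV2 ?posrE//.
      have [_|_] := leP s t; first by lra. by lra.
    by rewrite mulr_gt0// lt_max s0.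
  have x2 : (2^-1 < x)%R by move/negbT: t2; rewrite -ltNge => /lt_le_trans; apply.
  rewrite ifT ?mulr1; last by lra.
  by rewrite -(invrK 2%R) lef_pV2 ?posrE ?ltW// invr_gt0.
(* The average can exceed [J] only on two end intervals of length [s / 2], and total measure [s] is
   just what the rearrangement at [s] ignores. *)
apply: (@le_trans _ _ (lambda (`[0%R, (s / 2)%R[ `|` `](1 - s / 2)%R, 1%R]))).
  apply: le_measure; rewrite ?inE.
  - by apply: measurable_superlevel; exact: cesaro_measurable.
  - exact: measurableU.
  move=> x [/=]; rewrite in_itv/= => /andP[x0 x1].
  rewrite gee0_abs ?cesaro_ge0// => Jx; rewrite !in_itv/= x0 x1 andbT/=.
  apply/orP; rewrite !ltNge -negb_and; apply/negP => /CJ.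
  by rewrite leNgt Jx.
apply: le_trans (measureU2 _ _ _) _ => //.
have E1 : lambda `[0%R, (s / 2)%R[ <= (s / 2)%:E.
  by rewrite lebesgue_measure_itv/= lte_fin ifT ?sube0//; lra.
have E2 : lambda `](1 - s / 2)%R, 1%R] <= (s / 2)%:E.
  by rewrite lebesgue_measure_itv/= lte_fin ifT ?lee_fin; lra.
by apply: le_trans (leeD E1 E2) _; rewrite -EFinD lee_fin; lra.
Qed.

End pointwise_bounds.

(** * The two weights and their comparison *)

Section lorentz_weight.
Context {R : realType}.
Variable phi : R -> R.
Hypothesis phi_ge0 : {in `[0, 1], forall x, 0 <= phi x}.
Hypothesis phi_nd : {in `[0, 1] &, {homo phi : x y / x <= y}}.
Hypothesis phi_concave : @convex_function R R^o `[0, 1] (fun x => - phi x).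
Hypothesis phi0 : phi 0 = 0.
Hypothesis gamma_gt0 : 0 < lower_dilation_index phi.

Local Open Scope ereal_scope.
Local Notation lambda := (@lebesgue_measure R).
Local Notation mu := (lebesgue_stieltjes_measure (stieltjes_cdf phi)).
Local Notation I01 := (`[0%R, 1%R]%classic : set R).
Local Notation J01 := (`]0%R, 1%R]%classic : set R).
Local Notation C f := (cesaro_op (fun x => `|f x|%R)).

Let phi_rc := phi_right_continuous phi_ge0 phi_nd phi_concave phi0 gamma_gt0.
Let phi1_gt0 : (0 < phi 1)%R :=
  (lower_dilation_index_gt0P phi_ge0 phi_nd phi_concave phi0 gamma_gt0).1.

Lemma mu_itv_oc (a b : R) : (0 <= a)%R -> (a <= b)%R -> (b <= 1)%R ->
  mu `]a, b] = (phi b - phi a)%:E.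
Proof. exact: stieltjes_phi_itv_oc. Qed.

Lemma integral_mu_cst (c a b : R) : (0 <= a)%R -> (a <= b)%R -> (b <= 1)%R ->
  \int[mu]_(s in `]a, b]) c%:E = (c * (phi b - phi a))%:E.
Proof.
move=> a0 ab b1; rewrite integral_cst// EFinM; congr (_ * _).
exact: mu_itv_oc.
Qed.

Lemma integral_mu_step (c x : R) : (0 <= x <= 1)%R ->
  \int[mu]_(s in J01) (if (s <= x)%R then c else 0%R)%:E = (c * phi x)%:E.
Proof.
move=> /andP[x0 x1].
transitivity (\int[mu]_(s in `]0%R, x]) c%:E); last first.
  by rewrite integral_mu_cst// phi0 subr0.
have -> : `]0%R, x]%classic = J01 `&` [set t | (t <= x)%R].
  apply/seteqP; split=> t /=; rewrite !in_itv/=.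
    by move=> /andP[-> tx]; split => //; exact: le_trans x1.
  by move=> [/andP[-> _] ->].
rewrite integral_mkcondr; apply: eq_integral => t _.
rewrite patchE; case: ifPn => [tx|tx]; first by rewrite mem_set.
by rewrite memNset//; exact/negP.
Qed.

Definition near0_weight t : \bar R := \int[mu]_(s in J01) (near0_kernel (s, t))%:E.

Definition lower_weight t : \bar R := \int[mu]_(s in J01) (lower_kernel (s, t))%:E.

Definition upper_weight t : \bar R := \int[mu]_(s in J01) (upper_kernel (s, t))%:E.

Lemma measurable_kernel_section (k : R * R -> R) t (D : set R) :
  measurable_fun setT k -> measurable_fun D (fun s => (k (s, t))%:E).
Proof.
move=> mk; apply/measurable_EFinP; apply: measurable_funTS.
by apply: measurableT_comp => //; exact: pair2_measurable.
Qed.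

Lemma measurable_step (c x : R) (D : set R) :
  measurable_fun D (fun s => (if (s <= x)%R then c else 0%R)%:E).
Proof.
apply/measurable_EFinP; apply: measurable_funTS.
by apply: measurable_fun_ifT => //; exact: measurable_fun_ler.
Qed.

Lemma step_ge0 (c x s : R) : (0 <= c)%R -> 0 <= (if (s <= x)%R then c else 0%R)%:E.
Proof. by move=> c0; rewrite lee_fin; case: ifP. Qed.

Lemma J01_gt0 s : J01 s -> (0 < s)%R.
Proof. by rewrite /= in_itv/= => /andP[]. Qed.

Lemma near0_weight_ge0 t : 0 <= near0_weight t.
Proof.
by apply: integral_ge0 => s /J01_gt0/ltW s0; rewrite lee_fin near0_kernel_ge0.
Qed.

Lemma lower_weight_ge0 t : 0 <= lower_weight t.
Proof.
by apply: integral_ge0 => s /J01_gt0/ltW s0; rewrite lee_fin lower_kernel_ge0.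
Qed.

(** The second term rules near 1: it follows the length of [t, 1], the only part of the interval
    where the average sees mass placed at [t]. *)
Lemma lower_weightE t : (0 <= t <= 1)%R ->
  lower_weight t = near0_weight t + (phi ((1 - t) / 2))%:E.
Proof.
move=> /andP[t0 t1]; rewrite /lower_weight.
under eq_integral do rewrite EFinD.
rewrite ge0_integralD//; last 4 first.
- by move=> s /J01_gt0/ltW s0; rewrite lee_fin near0_kernel_ge0.
- exact: (measurable_kernel_section t (@measurable_near0_kernel R)).
- by move=> s _; rewrite lee_fin near1_kernel_ge0.
- exact: (measurable_kernel_section t (@measurable_near1_kernel R)).
congr (_ + _).
rewrite -[X in X%:E]mul1r -integral_mu_step; last by apply/andP; split; lra.
apply: eq_integral => s _; rewrite /near1_kernel/=.
congr (_%:E); congr (if _ then _ else _).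
by apply/idP/idP => ?; lra.
Qed.

(** The kernel is at least 1 / x on ]t, x]. Used with [x = t / a], where the contraction makes
    [phi x - phi t] comparable to [phi x]. *)
Lemma near0_weight_itv (t x : R) : (0 < t)%R -> (t <= x)%R -> (x <= 3^-1)%R ->
  (x^-1 * (phi x - phi t))%:E <= near0_weight t.
Proof.
move=> t0 tx x3; have x0 : (0 < x)%R by lra.
have tx01 : `]t, x]%classic `<=` J01.
  by move=> s /=; rewrite !in_itv/= => /andP[ts sx]; apply/andP; split; lra.
apply: (@le_trans _ _ (\int[mu]_(s in `]t, x]) (near0_kernel (s, t))%:E)).
  rewrite -integral_mu_cst ?(ltW t0)//; last by lra.
  apply: ge0_le_integral => //.
  - by move=> s _; rewrite lee_fin invr_ge0 ltW.
  - exact: (measurable_kernel_section t (@measurable_near0_kernel R)).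
  move=> s /=; rewrite in_itv/= => /andP[ts sx].
  rewrite /near0_kernel/= ifT; last by apply/andP; split; lra.
  by rewrite lee_fin lef_pV2 ?posrE; lra.
apply: ge0_subset_integral => //.
  exact: (measurable_kernel_section t (@measurable_near0_kernel R)).
by move=> s /J01_gt0/ltW s0; rewrite lee_fin near0_kernel_ge0.
Qed.

(** For these [t] the upper weight is exactly [phi (2 - 2 * t)]. Its argument is 4 times the one in
    [lower_weightE], and concavity turns that factor into the constant 4; the point [t = 1] is apart
    because the factor [u] to cancel is 0 there. *)
Lemma upper_weight_near1 t : (2^-1 < t)%R -> (t <= 1)%R ->
  upper_weight t <= 4%:E * lower_weight t.
Proof.
move=> t2 t1.
have -> : upper_weight t = (1 * phi (2 - 2 * t))%:E.
  rewrite -integral_mu_step; last by apply/andP; split; lra.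
  apply: eq_integral => s _; rewrite /upper_kernel/= leNgt t2/=.
  congr (_%:E); congr (if _ then _ else _).
  by apply/idP/idP => ?; lra.
rewrite lower_weightE; last by apply/andP; split; lra.
rewrite mul1r ge0_muleDr ?near0_weight_ge0//; last first.
  by rewrite lee_fin phi_ge0// in01; lra.
rewrite -[leLHS]add0e; apply: leeD; first by rewrite mule_ge0 ?near0_weight_ge0.
rewrite -EFinM lee_fin; have [->|t1'] := eqVneq t 1%R.
  by rewrite mulr1 !subrr mul0r phi0 mulr0.
have {}t1 : (t < 1)%R by rewrite lt_neqAle t1'.
set u := ((1 - t) / 2)%R; have -> : (2 - 2 * t = u * 4)%R by rewrite /u; lra.
have u0 : (0 < u)%R by rewrite /u; lra.
rewrite -(ler_pM2l u0) mulrA; apply: concave_star_shaped => //; rewrite /u; lra.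
Qed.

(** The upper weight exceeds [near0_weight] by a term phi(t) / t and a constant. The contraction
    bounds the first by [near0_weight] again, and the constant is absorbed by the near-1 term of the
    lower weight, which is bounded below for [t <= 1/2]. *)
Lemma upper_weight_near0 : exists2 c : R, (0 < c)%R &
  forall t, (0 <= t)%R -> (t <= 2^-1)%R -> upper_weight t <= c%:E * lower_weight t.
Proof.
have [_ [a [m [/andP[a0 a1] /andP[m0 m1] pm]]]] :=
  lower_dilation_index_gt0P phi_ge0 phi_nd phi_concave phi0 gamma_gt0.
have p4 : (0 < phi 4^-1)%R by apply: phi_gt0 => //; lra.
have ple1 t : (0 <= t)%R -> (t <= 1)%R -> (phi t <= phi 1)%R.
  by move=> t0 t1; apply: le_phi.
(* [c1] collects the multiples of [phi 1], [c2] those of [near0_weight t], and [c3] converts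
   [c1 * phi 1] into a multiple of [phi 4^-1]. *)
pose c1 := (3 + 3 / a)%R; pose c2 := (1 + m / ((1 - m) * a))%R.
pose c3 := (c1 * (phi 1 / phi 4^-1))%R.
have a0V : (0 < a^-1)%R by rewrite invr_gt0.
have c10 : (0 < c1)%R by rewrite /c1; lra.
have c20 : (0 < c2)%R.
  by rewrite /c2 ltr_wpDr// divr_ge0 ?(ltW m0)// mulr_ge0 ?(ltW a0)//; lra.
have c30 : (0 < c3)%R by rewrite mulr_gt0// divr_gt0.
exists (c2 + c3)%R; first by rewrite addr_gt0.
move=> t t0 t2.
(* The kernel is split at [s = t] and [s = 1/3]: it equals 1 / t up to [t], is [near0_kernel] in
   between, and is less than 3 beyond 1/3. *)
have step : upper_weight t <= (t^-1 * phi t)%:E + near0_weight t + (3 * phi 1)%:E.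
  apply: (@le_trans _ _ (\int[mu]_(s in J01) ((if (s <= t)%R then t^-1%R else 0%R)%:E +
      (near0_kernel (s, t))%:E + (if (s <= 1)%R then 3%R else 0%R)%:E))).
    apply: ge0_le_integral => //.
    - by move=> s /J01_gt0/ltW s0; rewrite lee_fin upper_kernel_ge0.
    - exact: (measurable_kernel_section t (@measurable_upper_kernel R)).
    - apply: emeasurable_funD; last exact: measurable_step.
      apply: emeasurable_funD; first exact: measurable_step.
      exact: (measurable_kernel_section t (@measurable_near0_kernel R)).
    move=> s; rewrite /= in_itv/= => /andP[s0 s1].
    rewrite -!EFinD lee_fin /upper_kernel/= t2 s1 /near0_kernel/=.
    have [st|ts] := leP s t.
      by rewrite -addrA lerDl addr_ge0//; case: ifP => // _; rewrite invr_ge0 ltW.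
    rewrite add0r (ltW ts)/=; case: ifPn => [|]; first by rewrite lerDl.
    rewrite -ltNge add0r => s3; rewrite -(invrK 3%R) lef_pV2 ?posrE ?ltW//.
  have near0_ge0 s : J01 s -> 0 <= (near0_kernel (s, t))%:E.
    by move=> /J01_gt0/ltW s0; rewrite lee_fin near0_kernel_ge0.
  have tV0 : (0 <= t^-1)%R by rewrite invr_ge0.
  rewrite ge0_integralD//; last 4 first.
  - by move=> s Js; rewrite adde_ge0 ?near0_ge0 ?step_ge0.
  - apply: emeasurable_funD; first exact: measurable_step.
    exact: (measurable_kernel_section t (@measurable_near0_kernel R)).
  - by move=> s _; rewrite step_ge0.
  - exact: measurable_step.
  rewrite ge0_integralD//; last 3 first.
  - by move=> s _; rewrite step_ge0.
  - exact: measurable_step.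
  - exact: (measurable_kernel_section t (@measurable_near0_kernel R)).
  rewrite le_eqVlt; apply/orP; left; apply/eqP; congr (_ + _ + _).
    by apply: integral_mu_step; apply/andP; split; lra.
  by apply: integral_mu_step; rewrite ler01 lexx.
(* If [t >= a / 3], then 1 / t <= 3 / a. Otherwise [t / a <= 1/3], and [phi t <= m * phi (t / a)]
   gives [(1 - m) * phi t <= m * (phi (t / a) - phi t)], whence the value of [c2 - 1]. *)
have phit : (t^-1 * phi t)%:E <= (3 / a * phi 1)%:E + (c2 - 1)%:E * near0_weight t.
  have c2E : (c2 - 1 = m / ((1 - m) * a))%R by rewrite /c2; ring.
  have c21 : (0 < m / ((1 - m) * a))%R.
    by rewrite divr_gt0// mulr_gt0//; lra.
  have N0 : 0 <= (c2 - 1)%:E * near0_weight t.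
    by rewrite c2E mule_ge0 ?near0_weight_ge0// lee_fin ltW.
  have p10 : (0 <= 3 / a * phi 1)%R by rewrite mulr_ge0 ?divr_ge0 ?ltW.
  have [t00|tn0] := eqVneq t 0%R.
    by move: N0; rewrite t00 phi0 mulr0 => N0; rewrite adde_ge0 ?lee_fin.
  have {tn0}t0 : (0 < t)%R by rewrite lt_neqAle eq_sym tn0.
  have [at3|ta] := leP (a / 3)%R t.
    rewrite -[leLHS]adde0; apply: leeD => //; rewrite lee_fin.
    apply: ler_pM; rewrite ?invr_ge0 ?(ltW t0)//.
    - by rewrite phi_ge0// in01 ?(ltW t0)//; lra.
    - by rewrite -[leRHS]invrK invf_div lef_pV2 ?posrE// divr_gt0.
    - by apply: ple1; lra.
  rewrite -[leLHS]add0e; apply: leeD; first by rewrite lee_fin.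
  have xa : (t / a * a = t)%R by rewrite divfK// gt_eqF.
  have x0 : (0 < t / a)%R by rewrite divr_gt0.
  have x3 : (t / a <= 3^-1)%R by rewrite ler_pdivrMr//; lra.
  have tx : (t <= t / a)%R by rewrite ler_pdivlMr// ger_pMr// ltW.
  have := near0_weight_itv t0 tx x3.
  move=> /(lee_wpmul2l _)-/(_ (c2 - 1)%:E); rewrite c2E lee_fin (ltW c21).
  move=> /(_ isT); apply: le_trans; rewrite -EFinM lee_fin.
  have := pm _ x0; rewrite xa => /(_ _)-h.
  have {h}h : (phi t <= m * phi (t / a))%R by apply: h; lra.
  rewrite invf_div mulrA.
  have -> : (m / ((1 - m) * a) * (a / t) = t^-1 * (m / (1 - m)))%R.
    by field; rewrite !gt_eqF//; lra.
  rewrite -mulrA ler_pM2l ?invr_gt0// mulrAC ler_pdivlMr; last by lra.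
  rewrite mulrBr mulrBr mulr1 (mulrC (phi t)); lra.
apply: le_trans step _.
rewrite lower_weightE; last by apply/andP; split; lra.
have pt4 : (phi 4^-1 <= phi ((1 - t) / 2))%R by apply: le_phi => //; lra.
have c3E : (c3 * phi 4^-1 = c1 * phi 1)%R by rewrite /c3; field; rewrite gt_eqF.
have : (c3 * phi 4^-1 <= c3 * phi ((1 - t) / 2))%R by rewrite ler_pM2l.
have : (0 <= c2 * phi ((1 - t) / 2))%R.
  by rewrite mulr_ge0 ?(ltW c20)//; lra.
(* The weight may be infinite at [t = 0]; the inequality is then trivial because [c2] and [c3] are
   positive. *)
move: phit (near0_weight_ge0 t); case: (near0_weight t) => [X| |]// phit X0 h1 h2.
  move: phit X0; rewrite -!EFinM -!EFinD !lee_fin => phit X0.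
  have : (0 <= c3 * X)%R by rewrite mulr_ge0// ltW.
  move: c3E; rewrite {1}/c1; lra.
by rewrite addye// gt0_muley ?leey// lte_fin addr_gt0.
Qed.

Lemma upper_weight_le_lower_weight : exists2 c : R, (0 < c)%R &
  forall t, I01 t -> upper_weight t <= c%:E * lower_weight t.
Proof.
have [c c0 hc] := upper_weight_near0; exists (c + 4)%R; first by rewrite addr_gt0.
move=> t; rewrite /= in_itv/= => /andP[t0 t1].
rewrite EFinD ge0_muleDl// ?lee_fin ?(ltW c0)//.
have [t2|t2] := leP t 2^-1%R.
  by rewrite -[leLHS]adde0; apply: leeD; rewrite ?hc// mule_ge0 ?lower_weight_ge0.
rewrite -[leLHS]add0e; apply: leeD; last exact: upper_weight_near1.
by rewrite mule_ge0 ?lower_weight_ge0// lee_fin ltW.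
Qed.

Lemma lorentz_normE (h : R -> \bar R) :
  lorentz_norm phi h = \int[mu]_(s in J01) rearrangement h s.
Proof.
rewrite -[J01](setDitv1l (BRight 1%R) (0%R : R) true).
apply: ge0_negligible_integral => //.
- exact: measurable_rearrangement.
- by move=> s _; exact: rearrangement_ge0.
- exact: stieltjes_phi_set1.
Qed.

Section equivalence.
Variable f : R -> R.
Hypothesis mf : measurable_fun I01 f.

Let mabs : measurable_fun I01 (fun t => `|f t|%:E).
Proof. by apply/measurable_EFinP; exact: measurableT_comp. Qed.

Lemma lorentz_cesaro_ge :
  \int[lambda]_(t in I01) (lower_weight t * `|f t|%:E) <= 4%:E * lorentz_norm phi (C f).
Proof.
have k0 s t : J01 s -> I01 t -> (0 <= lower_kernel (s, t))%R.
  by move=> /J01_gt0/ltW s0 _; rewrite lower_kernel_ge0.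
have mk := @measurable_lower_kernel R.
have abs0 (t : R) (_ : I01 t) : 0 <= `|f t|%:E by [].
have m1 := measurable_integral_kernel lambda (measurable_itv `]0%R, 1%R])
  (measurable_itv `[0%R, 1%R]) mk k0 mabs abs0.
rewrite lorentz_normE -ge0_integralZl//; last 2 first.
- exact: measurable_rearrangement.
- by move=> s _; exact: rearrangement_ge0.
rewrite -(tonelli_kernel mu lambda (measurable_itv `]0%R, 1%R])
  (measurable_itv `[0%R, 1%R]) mk k0 mabs abs0).
apply: ge0_le_integral => //.
- move=> s Js; apply: integral_ge0 => t It.
  by rewrite mule_ge0// lee_fin k0.
- apply: emeasurable_funM => //; exact: measurable_rearrangement.
move=> s; rewrite /= in_itv/= => s01; exact: lower_kernel_le_rearrangement.
Qed.

Lemma lorentz_cesaro_le (c : R) : (0 < c)%R ->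
  (forall t, I01 t -> upper_weight t <= c%:E * lower_weight t) ->
  lorentz_norm phi (C f) <=
  (2 * c)%:E * \int[lambda]_(t in I01) (lower_weight t * `|f t|%:E).
Proof.
move=> c0 hc.
have k0 s t : J01 s -> I01 t -> (0 <= upper_kernel (s, t))%R.
  by move=> /J01_gt0/ltW s0 _; rewrite upper_kernel_ge0.
have mk := @measurable_upper_kernel R.
have abs0 (t : R) (_ : I01 t) : 0 <= `|f t|%:E by [].
have m1 := measurable_integral_kernel lambda (measurable_itv `]0%R, 1%R])
  (measurable_itv `[0%R, 1%R]) mk k0 mabs abs0.
have ge0 s : J01 s -> 0 <= \int[lambda]_(t in I01) ((upper_kernel (s, t))%:E * `|f t|%:E).
  by move=> Js; apply: integral_ge0 => t It; rewrite mule_ge0// lee_fin k0.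
rewrite lorentz_normE EFinM -muleA.
apply: (@le_trans _ _ (2%:E * \int[mu]_(s in J01)
    \int[lambda]_(t in I01) ((upper_kernel (s, t))%:E * `|f t|%:E))).
  rewrite -ge0_integralZl//; apply: ge0_le_integral => //.
  - by move=> s _; exact: rearrangement_ge0.
  - exact: measurable_rearrangement.
  - exact: emeasurable_funM.
  move=> s Js; have := Js; rewrite /= in_itv/= => s01.
  apply: le_trans (rearrangement_le_upper_kernel mf s01) _.
  rewrite -ge0_integralZl//; last 2 first.
  - exact: measurable_kernel_abs.
  - by move=> t It; rewrite mule_ge0// lee_fin k0.
  rewrite le_eqVlt; apply/orP; left; apply/eqP; apply: eq_integral => t _.
  by rewrite EFinM muleA.
apply: lee_wpmul2l => //.
rewrite (tonelli_kernel mu lambda (measurable_itv `]0%R, 1%R])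
  (measurable_itv `[0%R, 1%R]) mk k0 mabs abs0).
have klow s t : J01 s -> I01 t -> (0 <= lower_kernel (s, t))%R.
  by move=> /J01_gt0/ltW s0 _; rewrite lower_kernel_ge0.
have mw : measurable_fun I01 lower_weight.
  exact: (measurable_kernel_integral mu (measurable_itv `]0%R, 1%R])
    (measurable_itv `[0%R, 1%R]) (@measurable_lower_kernel R) klow).
rewrite -ge0_integralZl//; last 3 first.
- exact: emeasurable_funM.
- by move=> t _; rewrite mule_ge0 ?lower_weight_ge0.
- by rewrite lee_fin ltW.
apply: ge0_le_integral => //.
- move=> t It; rewrite mule_ge0//; apply: integral_ge0 => s Js.
  by rewrite lee_fin k0.
- apply: emeasurable_funM => //.
  exact: (measurable_kernel_integral mu (measurable_itv `]0%R, 1%R])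
    (measurable_itv `[0%R, 1%R]) mk k0).
- by apply: emeasurable_funM => //; exact: emeasurable_funM.
by move=> t It; rewrite muleA; apply: lee_wpmul2r => //; exact: hc.
Qed.

End equivalence.

End lorentz_weight.

(** * Spaces normed by a weighted L^1 norm, up to equivalence *)

Section weighted_L1.
Context {R : realType}.
Local Notation lambda := (@lebesgue_measure R).
Local Notation I01 := (`[0%R, 1%R]%classic : set R).
Let mI01 : measurable (`[0%R, 1%R]%classic : set (measurableTypeR R)) :=
  measurable_itv `[0%R, 1%R].

(** The endpoints have to be dropped: the lower weight may be infinite at 0 and vanishes at 1. *)
Lemma ae_itv_interior (P : R -> Prop) :
  (forall x, 0 < x -> x < 1 -> P x) ->
  {ae (lambda : {measure set (measurableTypeR R) -> \bar R}), forall x, I01 x -> P x}.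
Proof.
move=> HP; exists [set 0; 1]; split => //.
- by apply: measurableU.
- apply/eqP; rewrite eq_le measure_ge0 andbT.
  apply: le_trans (measureU2 _ _ _) _ => //.
  rewrite [X in (X + _)%E](lebesgue_measure_set1 0).
  by rewrite [X in (_ + X)%E](lebesgue_measure_set1 1) adde0.
move=> x /=; apply: contra_notP => /not_orP[x0 x1].
rewrite in_itv/= => /andP[]; rewrite !le_eqVlt.
move=> /predU1P[/esym//|xgt0] /predU1P[//|xlt1].
exact: HP.
Qed.

Variables (D : set (R -> R)) (N : (R -> R) -> \bar R) (w : R -> R) (c1 c2 : R).
Hypotheses (c1_gt0 : 0 < c1) (c2_gt0 : 0 < c2).
Hypothesis mw : measurable_fun I01 w.
Hypothesis w_ge0 : forall t, 0 <= w t.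
Hypothesis w_gt0 : forall t, 0 < t -> t < 1 -> 0 < w t.
Hypothesis DE : forall f, D f <-> measurable_fun I01 f /\
  (\int[lambda]_(t in I01) (`|f t| * w t)%:E < +oo)%E.
Hypothesis N_le : forall f : R -> R, measurable_fun I01 f ->
  (N f <= c1%:E * \int[lambda]_(t in I01) (`|f t| * w t)%:E)%E.
Hypothesis N_ge : forall f : R -> R, measurable_fun I01 f ->
  (\int[lambda]_(t in I01) (`|f t| * w t)%:E <= c2%:E * N f)%E.

Let V := L1 lambda mI01.
(** Multiplication by [w] carries the weighted norm to the plain L^1 norm, and it commutes with
    maxima and minima because [w] is nonnegative. *)
Let T (f : R -> R) : V := L1_class lambda mI01 (fun t => f t * w t).

Let absM (f : R -> R) t : `|f t * w t| = `|f t| * w t.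
Proof. by rewrite normrM (ger0_norm (w_ge0 t)). Qed.

Let D_L1 f : D f -> (fun t => f t * w t) \in L1_fun lambda I01.
Proof.
move=> /DE[mf foo]; apply/L1_funP/integrableP; split.
  by apply/measurable_EFinP; exact: measurable_funM.
by under eq_integral do rewrite /= absM.
Qed.

Let L1_D (f : R -> R) : measurable_fun I01 f ->
  (fun t => f t * w t) \in L1_fun lambda I01 -> D f.
Proof.
move=> mf /L1_funP/integrableP[_ foo]; apply/DE; split => //.
by move: foo; under eq_integral do rewrite /= absM.
Qed.

Let T_norm f : D f -> (`|T f|%:E = \int[lambda]_(t in I01) (`|f t| * w t)%:E)%E.
Proof.
move=> /D_L1 fi; rewrite L1_class_norm//.
by apply: eq_integral => t _; rewrite absM.
Qed.

Let T_linear (a : R) f g : D f -> D g ->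
  T (fun x => a * f x + g x) = a *: T f + T g.
Proof.
move=> /D_L1 fi /D_L1 gi.
rewrite L1_scaleE L1_addE /T -(L1_classZ mI01 a fi).
rewrite -(L1_classD mI01 (L1_funZ mI01 a fi) gi).
by congr L1_class; apply/funext => x; rewrite mulrDl mulrA.
Qed.

Let D_linear (a : R) f g : D f -> D g -> D (fun x => a * f x + g x).
Proof.
move=> Df Dg; have [mf _] := (DE f).1 Df; have [mg _] := (DE g).1 Dg.
apply: L1_D.
  by apply: measurable_funD => //; exact: measurable_funM.
rewrite (_ : (fun t => _) = (fun t => a * (f t * w t) + g t * w t)); last first.
  by apply/funext => x; rewrite mulrDl mulrA.
by apply: L1_funD => //; [apply: L1_funZ => //|]; exact: D_L1.
Qed.

Let T_sub f g : D f -> D g ->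
  D (fun x => g x - f x) /\ T (fun x => g x - f x) = T g - T f.
Proof.
move=> Df Dg; rewrite (_ : (fun x => _) = (fun x => -1 * f x + g x)); last first.
  by apply/funext => x; rewrite mulN1r addrC.
by split; [exact: D_linear|rewrite T_linear// scaleN1r addrC].
Qed.

Lemma weighted_L1_order_isomorphism : order_isomorphic_to_AL_space D N.
Proof.
have aeF :=
  ae_filter_ringOfSetsType (lambda : {measure set (measurableTypeR R) -> \bar R}).
exists V, (L1_lattice lambda mI01), T; split; first exact: L1_AL_space.
split.
- move=> f g Df Dg; rewrite /T L1_class_eq ?D_L1//; split.
    have := ae_itv_interior w_gt0; apply: filterS2 => x wx + Dx.
    by move=> /(_ Dx)/mulIf; apply; rewrite gt_eqF// wx.
  by apply: filterS => x /[apply] ->.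
- elim/L1_ind => h hi; pose f t := h t * (w t)^-1.
  have mh := L1_fun_measurable hi.
  have mf : measurable_fun I01 f.
    apply: measurable_funM => //; apply: measurableT_comp => //.
    exact: invr_measurable.
  (* Where [w] vanishes, [f] is 0 by the convention on [0^-1], so the product is dominated by [h] at
     every point. *)
  have fw : (fun t => f t * w t) \in L1_fun lambda I01.
    apply: (L1_fun_le mI01 _ _ (L1_fun_norm hi)).
      exact: measurable_funM.
    move=> t _; rewrite /f; have [->|w0] := eqVneq (w t) 0.
      by rewrite mulr0 normr0.
    by rewrite divfK.
  exists f; first exact: L1_D.
  rewrite /T; apply/L1_class_eq => //.
  have := ae_itv_interior w_gt0; apply: filterS => x /[apply] wx.
  by rewrite /f divfK// gt_eqF.
- exact: T_linear.
- move=> f g /D_L1 fi /D_L1 gi; split.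
    rewrite /T -[RHS](L1_class_max mI01 fi gi); congr L1_class.
    by apply/funext => x; rewrite maxr_pMl.
  rewrite /T -[RHS](L1_class_min mI01 fi gi); congr L1_class.
  by apply/funext => x; rewrite minr_pMl.
- split=> f Df e e0.
    exists (e / c2); first by rewrite divr_gt0.
    move=> g Dg Nlt; have [Dfg TE] := T_sub Df Dg.
    rewrite -TE -lte_fin T_norm//.
    apply: le_lt_trans (N_ge _) _; first by case/DE: Dfg.
    by rewrite -lte_pdivlMl// -EFinM mulrC.
  exists (e / c1); first by rewrite divr_gt0.
  move=> g Dg; have [Dfg TE] := T_sub Df Dg.
  rewrite -TE -lte_fin T_norm// => Tlt.
  apply: le_lt_trans (N_le _) _; first by case/DE: Dfg.
  by rewrite -lte_pdivlMl// -EFinM mulrC.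
Qed.

End weighted_L1.

(** * Identification of the Cesaro-Lorentz space with a weighted L^1 *)

Section lorentz.
Context {R : realType}.
Variable phi : R -> R.
Hypothesis phi_ge0 : {in `[0, 1], forall x, 0 <= phi x}.
Hypothesis phi_nd : {in `[0, 1] &, {homo phi : x y / x <= y}}.
Hypothesis phi_concave : @convex_function R R^o `[0, 1] (fun x => - phi x).
Hypothesis phi0 : phi 0 = 0.
Hypothesis gamma_gt0 : 0 < lower_dilation_index phi.

Local Open Scope ereal_scope.
Local Notation lambda := (@lebesgue_measure R).
Local Notation mu := (lebesgue_stieltjes_measure (stieltjes_cdf phi)).
Local Notation I01 := (`[0%R, 1%R]%classic : set R).
Local Notation J01 := (`]0%R, 1%R]%classic : set R).
Local Notation C f := (cesaro_op (fun x => `|f x|%R)).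

Let phi1_gt0 : (0 < phi 1)%R :=
  (lower_dilation_index_gt0P phi_ge0 phi_nd phi_concave phi0 gamma_gt0).1.

Lemma lower_weight_ge t : (0 <= t)%R -> (t < 1)%R ->
  (phi ((1 - t) / 2))%:E <= lower_weight phi t.
Proof.
move=> t0 t1; rewrite (lower_weightE phi_ge0 phi_nd phi_concave phi0 gamma_gt0).
  by rewrite leeDr// near0_weight_ge0.
by apply/andP; split; lra.
Qed.

Lemma lower_weight_fin_num t : (0 < t)%R -> (t < 1)%R -> lower_weight phi t \is a fin_num.
Proof.
move=> t0 t1; rewrite ge0_fin_numE ?lower_weight_ge0//.
rewrite (lower_weightE phi_ge0 phi_nd phi_concave phi0 gamma_gt0); last first.
  by apply/andP; split; lra.
apply: lte_add_pinfty; last exact: ltry.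
apply: (@le_lt_trans _ _ (\int[mu]_(s in J01) (t^-1)%:E)).
  apply: ge0_le_integral => //.
  - by move=> s /J01_gt0/ltW s0; rewrite lee_fin near0_kernel_ge0.
  - exact: (measurable_kernel_section t (@measurable_near0_kernel R)).
  move=> s /J01_gt0 s0; rewrite lee_fin /near0_kernel/=.
  case: ifP => [/andP[ts _]|_]; last by rewrite invr_ge0 ltW.
  by rewrite lef_pV2.
rewrite (integral_mu_cst phi_ge0 phi_nd phi_concave phi0 gamma_gt0)//.
exact: ltry.
Qed.

Lemma cesaro_lorentz_AL :
  order_isomorphic_to_AL_space
    (cesaro_space (lorentz_space phi)) (cesaro_norm (lorentz_norm phi)).
Proof.
have [c c0 hc] := upper_weight_le_lower_weight phi_ge0 phi_nd phi_concave phi0 gamma_gt0.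
have mw : measurable_fun I01 (lower_weight phi).
  apply: (measurable_kernel_integral mu (measurable_itv `]0%R, 1%R])
    (measurable_itv `[0%R, 1%R]) (@measurable_lower_kernel R)).
  by move=> s t /J01_gt0/ltW s0 _; rewrite lower_kernel_ge0.
pose w t := fine (lower_weight phi t).
have intE (f : R -> R) : measurable_fun I01 f ->
    \int[lambda]_(t in I01) (lower_weight phi t * `|f t|%:E) =
    \int[lambda]_(t in I01) (`|f t| * w t)%:E.
  move=> mf; apply: ge0_ae_eq_integral => //.
  - apply: emeasurable_funM => //.
    by apply/measurable_EFinP; exact: measurableT_comp.
  - apply/measurable_EFinP; apply: measurable_funM.
      exact: measurableT_comp.
    exact: measurableT_comp.
  - by move=> t _; rewrite mule_ge0 ?lower_weight_ge0.
  - by move=> t _; rewrite lee_fin mulr_ge0// fine_ge0// lower_weight_ge0.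
  apply: ae_itv_interior => t t0 t1.
  by rewrite EFinM fineK ?lower_weight_fin_num// muleC.
have Nge (f : R -> R) : measurable_fun I01 f ->
    \int[lambda]_(t in I01) (`|f t| * w t)%:E <= 4%:E * cesaro_norm (lorentz_norm phi) f.
  move=> mf; rewrite -intE//.
  exact: (lorentz_cesaro_ge phi_ge0 phi_nd phi_concave phi0 gamma_gt0).
have Nle (f : R -> R) : measurable_fun I01 f -> cesaro_norm (lorentz_norm phi) f <=
    (2 * c)%:E * \int[lambda]_(t in I01) (`|f t| * w t)%:E.
  move=> mf; rewrite -intE//.
  exact: (lorentz_cesaro_le phi_ge0 phi_nd phi_concave phi0 gamma_gt0).
apply: (@weighted_L1_order_isomorphism _ _ _ w (2 * c) 4) => //.
- by rewrite mulr_gt0.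
- exact: measurableT_comp.
- by move=> t; rewrite fine_ge0// lower_weight_ge0.
- move=> t t0 t1; rewrite fine_gt0//; apply/andP; split; last first.
    by rewrite -ge0_fin_numE ?lower_weight_ge0// lower_weight_fin_num.
  apply: lt_le_trans (lower_weight_ge (ltW t0) t1).
  by rewrite lte_fin (phi_gt0 phi_concave phi0 phi1_gt0)//; lra.
move=> f; split=> [[mf [_ _ Noo]]|[mf foo]]; split; [exact: mf| |exact: mf|].
  apply: le_lt_trans (Nge _ mf) _.
  by rewrite lte_mul_pinfty.
split; first exact: cesaro_measurable.
  (* Membership includes finiteness a.e. of the average. On [0, x] with x < 1 the weight is at least
     [phi ((1 - x) / 2)], which is positive, so the weighted integral controls the primitive at
     x. *)
  apply: (@ae_itv_interior _ (fun x => C f x \is a fin_num)) => x x0 x1.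
  rewrite fin_numM// ge0_fin_numE ?integral_ge0//.
  have p0 : (0 < phi ((1 - x) / 2))%R.
    by rewrite (phi_gt0 phi_concave phi0 phi1_gt0)//; lra.
  rewrite -[X in X < _]mul1e -(@divff _ (phi ((1 - x) / 2))) ?gt_eqF//.
  rewrite mulrC EFinM -muleA lte_mul_pinfty ?lee_fin ?invr_ge0 ?(ltW p0)//.
  apply: le_lt_trans foo; rewrite -intE//.
  have x01 : `[0%R, x]%classic `<=` I01 by apply: subset_itvl; rewrite bnd_simp ltW.
  have mabs : measurable_fun I01 (fun t => `|f t|%:E).
    by apply/measurable_EFinP; exact: measurableT_comp.
  rewrite -ge0_integralZl_EFin ?(ltW p0)//; last exact: measurable_funS mabs.
  apply: (@le_trans _ _ (\int[lambda]_(t in `[0%R, x]) (lower_weight phi t * `|f t|%:E))).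
    apply: ge0_le_integral => //.
    - by move=> t _; rewrite mule_ge0// lee_fin ltW.
    - by apply: emeasurable_funM => //; exact: measurable_funS mabs.
    - apply: (measurable_funS _ x01) => //; exact: emeasurable_funM.
    move=> t; rewrite /= in_itv/= => /andP[t0 tx].
    apply: lee_wpmul2r => //; apply: le_trans (lower_weight_ge t0 _); last lra.
    by rewrite lee_fin (le_phi phi_nd)//; lra.
  apply: ge0_subset_integral => //; first exact: emeasurable_funM.
  by move=> t _; rewrite mule_ge0 ?lower_weight_ge0.
apply: le_lt_trans (Nle _ mf) _.
by rewrite lte_mul_pinfty// lee_fin mulr_ge0// ltW.
Qed.

End lorentz.

(** * Marcinkiewicz spaces *)

Section banach_lattices.
Context {R : realType} {E : completeNormedModType R} (L : banach_lattice E).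

Lemma bl_le_joinl x y : bl_le L x (bl_join L x y).
Proof.
have := bl_le_refl L (bl_join L x y).
by rewrite bl_leUx => /andP[].
Qed.

Lemma bl_join_idPl x y : bl_join L x y = y -> bl_le L x y.
Proof. by move=> xy; have := bl_le_joinl x y; rewrite xy. Qed.

Lemma bl_ge0_abs x : bl_le L 0 x -> bl_abs L x = x.
Proof.
move=> x0; apply: (bl_le_anti (b := L)); apply/andP; split; last exact: bl_le_joinl.
rewrite bl_leUx bl_le_refl/=; apply: (@bl_le_trans _ _ L 0) => //.
by have := bl_leD2r (- x) x0; rewrite add0r subrr.
Qed.

End banach_lattices.

Section disjoint_sequences.
Context {R : realType}.

(* In an AL-space the norms of the disjoint elements T (u n), which all lie below
   T g, would be summable. *)
Lemma not_AL_disjoint_sequence (D : set (R -> R)) (N : (R -> R) -> \bar R)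
    (u S : nat -> R -> R) (g : R -> R) (e : R) :
  0 < e -> D (cst 0) -> D g -> (forall n, D (u n)) -> (forall n, D (S n)) ->
  (forall n x, 0 <= u n x) -> (forall n x, 0 <= S n x <= g x) ->
  (forall n x, S n.+1 x = S n x + u n x) ->
  (forall n x, Num.min (S n x) (u n x) = 0) ->
  (forall n, (e%:E <= N (u n))%E) ->
  ~ order_isomorphic_to_AL_space D N.
Proof.
move=> e0 D0 Dg Du DS u0 Sg SS Su Nu [E [L [T [ALL [_ _ Tlin Tlat [_ Tinv]]]]]].
have T0 : T (cst 0) = 0.
  have := Tlin 1 _ _ D0 D0; rewrite scale1r.
  rewrite (_ : (fun x => _) = cst 0); last by apply/funext => x; rewrite mulr0 addr0.
  by move/eqP; rewrite -subr_eq0 opprD addrA subrr sub0r oppr_eq0 => /eqP.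
have T_le f h : D f -> D h -> (forall x, f x <= h x) -> bl_le L (T f) (T h).
  move=> Df Dh fh; apply: bl_join_idPl; rewrite -(Tlat _ _ Df Dh).1.
  by congr T; apply/funext => x; rewrite max_r.
have T_abs f : D f -> (forall x, 0 <= f x) -> bl_abs L (T f) = T f.
  by move=> Df f0; apply: bl_ge0_abs; rewrite -T0; exact: T_le.
(* Continuity of the inverse of [T] at 0, used by contraposition: [N (u n) >= e] keeps [T (u n)] at
   distance at least [r] from 0. *)
have [r r0 Tr] := Tinv _ D0 _ e0.
have ur n : r <= `|T (u n)|.
  rewrite leNgt; apply/negP => ur.
  have := Tr _ (Du n); rewrite T0 subr0 => /(_ ur).
  rewrite (_ : (fun x => _) = u n); last by apply/funext => x; rewrite subr0.
  by rewrite ltNge Nu.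
have S0 n x : 0 <= S n x by have /andP[] := Sg n x.
(* [S n] and [u n] are disjoint, so each step adds at least [r] to the norm. *)
have Sr n : n%:R * r <= `|T (S n)|.
  elim: n => [|n ih]; first by rewrite mul0r.
  have -> : S n.+1 = (fun x => 1 * S n x + u n x).
    by apply/funext => x; rewrite SS mul1r.
  rewrite Tlin// scale1r ALL; last first.
    rewrite !T_abs// -(Tlat _ _ (DS n) (Du n)).2 -T0.
    by congr T; apply/funext => x; rewrite Su.
  by rewrite -natr1 mulrDl mul1r lerD.
have Sub n : `|T (S n)| <= `|T g|.
  apply: (@bl_le_norm _ _ L); rewrite -!/(bl_abs L _) !T_abs//.
    by apply: T_le => // x; have /andP[] := Sg n x.
  by move=> x; have /andP[/le_trans] := Sg n x; apply.
have := truncnS_gt (`|T g| / r); rewrite ltr_pdivrMr// ltNge.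
by rewrite (le_trans (Sr _) (Sub _)).
Qed.

End disjoint_sequences.

(** * The function 1 / phi and its dyadic pieces *)

Section marcinkiewicz.
Context {R : realType}.
Variable phi : R -> R.
Hypothesis phi_ge0 : {in `[0, 1], forall x, 0 <= phi x}.
Hypothesis phi_nd : {in `[0, 1] &, {homo phi : x y / x <= y}}.
Hypothesis phi_concave : @convex_function R R^o `[0, 1] (fun x => - phi x).
Hypothesis phi0 : phi 0 = 0.
Hypothesis phi1_gt0 : 0 < phi 1.

Local Notation lambda := (@lebesgue_measure R).
Local Notation I01 := (`[0%R, 1%R]%classic : set R).
Local Notation C f := (cesaro_op (fun x => `|f x|%R)).

Let phi_pos s : 0 < s -> s <= 1 -> 0 < phi s.
Proof. exact: (phi_gt0 phi_concave phi0 phi1_gt0). Qed.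

(** With half-open intervals, adjacent pieces are disjoint and add up at every point, as
    [not_AL_disjoint_sequence] demands. *)
Definition inv_piece (a b x : R) : R := if (a < x) && (x <= b) then (phi x)^-1 else 0.

Local Notation g := (inv_piece 0 1).

Lemma inv_piece_ge0 a b x : 0 <= a -> b <= 1 -> 0 <= inv_piece a b x.
Proof.
move=> a0 b1; rewrite /inv_piece; case: ifP => // /andP[ax xb].
by rewrite invr_ge0 phi_ge0// in01; lra.
Qed.

Lemma inv_piece_le a b x : 0 <= a -> b <= 1 -> inv_piece a b x <= g x.
Proof.
move=> a0 b1; rewrite {1}/inv_piece; case: ifP => [/andP[ax xb]|_].
  by rewrite /inv_piece ifT//; apply/andP; split; lra.
exact: inv_piece_ge0.
Qed.

Lemma measurable_inv_piece a b : measurable_fun I01 (inv_piece a b).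
Proof.
apply: measurable_fun_if => //.
- apply: measurable_funTS; apply: measurable_and; first exact: measurable_fun_ltr.
  exact: measurable_fun_ler.
- apply: (measurable_funS (measurable_itv `[0%R, 1%R])); first exact: subIsetl.
  apply: (measurableT_comp invr_measurable).
  apply/measurable_EFinP; apply: ereal_nondecreasing_measurable => // x y.
  by rewrite !inE/= => x01 y01 xy; rewrite lee_fin phi_nd.
Qed.

Variables t q : R.
Hypotheses (t_gt1 : 1 < t) (q_gt0 : 0 < q) (q_lt1 : q < 1).
Hypothesis phiM : forall s, 0 < s -> s * t <= 1 -> phi (s * t) <= q * t * phi s.

(* K solves K = q t + q K, which is the recursion from x / t to x below. *)
Local Notation K := (q * t / (1 - q))%R.

Let t_gt0 : 0 < t. Proof. by rewrite (lt_trans _ t_gt1). Qed.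

Let K_gt0 : 0 < K.
Proof. by rewrite divr_gt0 ?mulr_gt0// subr_gt0. Qed.

Let mg (i : interval R) : [set` i] `<=` I01 ->
  measurable_fun [set` i] (fun x => (g x)%:E).
Proof.
move=> i01; apply/measurable_EFinP.
by apply: measurable_funS (measurable_inv_piece 0 1).
Qed.

Local Open Scope ereal_scope.

(** Over ]0, x] the recursion from x / t to x would also be satisfied by an infinite integral.
    Truncation at [x / t ^+ n] starts the induction from an empty interval and gives a bound
    independent of [n]. *)
Lemma integral_inv_itv n x : (0 < x <= 1)%R ->
  \int[lambda]_(s in `](x / t ^+ n)%R, x]) (g s)%:E <= (K * x / phi x)%:E.
Proof.
elim: n x => [|n ih] x /andP[x0 x1].
  rewrite expr0 divr1 set_itvoc0 integral_set0 lee_fin.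
  have px := phi_pos x0 x1.
  exact: divr_ge0 (mulr_ge0 (ltW K_gt0) (ltW x0)) (ltW px).
have xt0 : (0 < x / t)%R by rewrite divr_gt0.
have xtx : (x / t <= x)%R by rewrite ler_pdivrMr// ler_peMr// ltW.
have xt1 : (x / t <= 1)%R by exact: le_trans xtx x1.
have tn1 : (1 <= t ^+ n)%R by rewrite exprn_ege1// ltW.
have xtn : (x / t ^+ n.+1 = x / t / t ^+ n)%R.
  by rewrite exprS invfM mulrA.
have xtnx : (x / t / t ^+ n <= x / t)%R.
  by rewrite ler_pdivrMr ?exprn_gt0// ler_peMr// ltW.
have xtn0 : (0 < x / t / t ^+ n)%R by rewrite divr_gt0// exprn_gt0.
rewrite xtn (@itv_bndbnd_setU _ _ _ (BRight (x / t)%R)) ?bnd_simp//.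
have sub (i : interval R) : [set` i] `<=` `](x / t / t ^+ n)%R, x] -> [set` i] `<=` I01.
  move=> h y /h; rewrite /= !in_itv/= => /andP[? ?]; apply/andP; split; lra.
rewrite ge0_integral_setU//; last 3 first.
- by rewrite -itv_bndbnd_setU ?bnd_simp//; apply: mg; exact: sub.
- by move=> y _; rewrite lee_fin inv_piece_ge0.
- rewrite disj_set2E; apply/eqP; rewrite -subset0 => y [] /=.
  by rewrite !in_itv/= => /andP[_ y1] /andP[y2 _]; lra.
have pxt : (0 < phi (x / t))%R by exact: phi_pos.
have px : (0 < phi x)%R by exact: phi_pos.
(* The dilation inequality at [x / t]. It serves twice: for the tail up to [x / t], and for the
   integrand on ]x / t, x], which is at most its value at the left end. *)
have hq : ((phi (x / t))^-1 <= q * t / phi x)%R.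
  have := phiM xt0; rewrite divfK ?gt_eqF// => /(_ x1) h.
  by rewrite ler_pdivlMr// mulrC ler_pdivrMr.
have qt0 : (0 <= q * t / phi x)%R.
  exact: divr_ge0 (mulr_ge0 (ltW q_gt0) (ltW t_gt0)) (ltW px).
have h1 : \int[lambda]_(s in `](x / t / t ^+ n)%R, (x / t)%R]) (g s)%:E <=
    (K * (x / t) * (q * t / phi x))%:E.
  apply: le_trans (ih (x / t)%R _) _; first by rewrite xt0.
  by rewrite lee_fin; apply: ler_wpM2l => //; exact: mulr_ge0 (ltW K_gt0) (ltW xt0).
have h2 : \int[lambda]_(s in `](x / t)%R, x]) (g s)%:E <= (x * (q * t / phi x))%:E.
  apply: (@le_trans _ _ (\int[lambda]_(s in `](x / t)%R, x]) (q * t / phi x)%:E)).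
    apply: ge0_le_integral => //.
    - by move=> s _; rewrite lee_fin inv_piece_ge0.
    - by apply: mg => y; rewrite /= !in_itv/= => /andP[? ?]; apply/andP; split; lra.
    move=> s; rewrite /= in_itv/= => /andP[xs sx].
    rewrite lee_fin /inv_piece ifT; last by apply/andP; split; lra.
    apply: le_trans hq; rewrite lef_pV2 ?posrE ?phi_pos//; try lra.
    by apply: (le_phi phi_nd); lra.
  rewrite integral_cst//= lebesgue_measure_itv/=; case: ifP => _; last first.
    by rewrite mule0 lee_fin mulr_ge0// ltW.
  by rewrite -EFinM lee_fin mulrC ler_wpM2r//; lra.
apply: le_trans (leeD h1 h2) _; rewrite -EFinD lee_fin.
rewrite le_eqVlt; apply/orP; left; apply/eqP; field.
by rewrite !gt_eqF// subr_gt0.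
Qed.

Lemma integral_inv x : (0 < x <= 1)%R ->
  \int[lambda]_(s in `[0%R, x]) (g s)%:E <= (K * x / phi x)%:E.
Proof.
move=> x01; have /andP[x0 x1] := x01.
have sub (i : interval R) : [set` i] `<=` `]0%R, x] -> [set` i] `<=` I01.
  by move=> h y /h; rewrite /= !in_itv/= => /andP[? ?]; apply/andP; split; lra.
rewrite -integral_itv_obnd_cbnd; last by apply: mg; exact: sub.
have xtn0 n : (0 < x / t ^+ n)%R by rewrite divr_gt0// exprn_gt0.
have subn n : `](x / t ^+ n)%R, x] `<=` `]0%R, x].
  by apply: subset_itvr; rewrite bnd_simp ltW.
have -> : `]0%R, x]%classic = \bigcup_n `](x / t ^+ n)%R, x]%classic.
  apply/seteqP; split=> [y|y [n _ /subn]//]; rewrite /= in_itv/= => /andP[y0 yx].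
  have : (t^-1 ^+ n)%R @[n --> \oo] --> (0 : R)%R.
    by apply: cvg_expr; rewrite gtr0_norm ?invr_gt0// invf_lt1.
  have yx0 : (0 < y / x)%R by rewrite divr_gt0.
  move=> /cvgrPdist_lt/(_ _ yx0)[n _ /(_ n)]; rewrite /= leqnn => /(_ isT).
  rewrite sub0r normrN ger0_norm ?exprn_ge0 ?invr_ge0 ?(ltW t_gt0)// exprVn => tn.
  exists n => //=; rewrite in_itv/= yx andbT.
  by rewrite mulrC -ltr_pdivlMr.
have cv : \int[lambda]_(s in `](x / t ^+ n)%R, x]) (g s)%:E @[n --> \oo] -->
    \int[lambda]_(s in \bigcup_n `](x / t ^+ n)%R, x]%classic) (g s)%:E.
  apply: ge0_nondecreasing_set_cvg_integral => //.
  - apply/nondecreasing_seqP => n; rewrite subsetEset; apply: subset_itvr.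
    rewrite bnd_simp ler_pM2l// lef_pV2 ?posrE ?exprn_gt0//.
    by rewrite exprS ler_peMl ?exprn_ge0 ?(ltW t_gt0) ?(ltW t_gt1).
  - by move=> n; apply: mg; apply: sub; exact: subn.
  - by move=> n y _; rewrite lee_fin inv_piece_ge0.
rewrite -(cvg_lim _ cv)//; apply: lime_le; first exact: cvgP cv.
by apply: nearW => n; exact: integral_inv_itv.
Qed.

Section upper_bound.
Variable f : R -> R.
Hypothesis mf : measurable_fun I01 f.
Hypothesis fg : forall x, I01 x -> (`|f x| <= g x)%R.

Lemma cesaro_inv_le x : (0 < x <= 1)%R -> C f x <= (K / phi x)%:E.
Proof.
move=> x01; have /andP[x0 x1] := x01.
have sub : `[0%R, x]%classic `<=` I01 by apply: subset_itvl; rewrite bnd_simp.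
apply: (@le_trans _ _ (x^-1%:E * (K * x / phi x)%:E)); last first.
  rewrite -EFinM lee_fin (_ : x^-1 * (K * x / phi x) = K / phi x)%R//.
  by field; rewrite !gt_eqF ?subr_gt0 ?phi_pos.
rewrite /cesaro_op lee_wpmul2l ?lee_fin ?invr_ge0 ?(ltW x0)//.
apply: le_trans (integral_inv x01); apply: ge0_le_integral => //.
- apply/measurable_EFinP; apply: measurableT_comp => //.
  exact: measurable_funS mf.
- exact: mg.
- by move=> s /sub /fg; rewrite lee_fin.
Qed.

(** The pointwise bound [K / phi] is nonincreasing, so the average can exceed its value at [s] only
    on [0, s[. *)
Lemma rearrangement_inv_le s : (0 < s <= 1)%R ->
  rearrangement (C f) s <= (K / phi s)%:E.
Proof.
move=> /andP[s0 s1]; have ps := phi_pos s0 s1.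
have K0 : (0 <= K / phi s)%R by rewrite divr_ge0 ?(ltW K_gt0) ?(ltW ps).
apply: rearrangement_le => //.
apply: (@le_trans _ _ (lambda `[0%R, s[)); last first.
  by rewrite lebesgue_measure_itv/= lte_fin s0 sube0.
apply: le_measure; rewrite ?inE//.
  by apply: measurable_superlevel; exact: cesaro_measurable.
move=> x [/=]; rewrite !in_itv/= => /andP[x0 x1].
rewrite gee0_abs ?cesaro_ge0// x0/= => Kx; rewrite ltNge; apply/negP => sx.
have xpos : (0 < x <= 1)%R by rewrite (lt_le_trans s0 sx).
move: Kx; rewrite ltNge (le_trans (cesaro_inv_le xpos))// lee_fin.
rewrite ler_pM2l ?K_gt0// lef_pV2 ?posrE ?phi_pos//; last by lra.
by apply: (le_phi phi_nd); lra.
Qed.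

(** [integral_inv] is used twice, each time at the price of one factor [K]: for the Cesaro average
    and for the average inside the norm. *)
Lemma marcinkiewicz_inv_le : marcinkiewicz_norm phi (C f) <= (K * K)%:E.
Proof.
apply: ge_ereal_sup => _ [x /= + <-]; rewrite in_itv/= => x01.
have /andP[x0 x1] := x01; have px := phi_pos x0 x1.
have px0 : (0 <= phi x / x)%R by rewrite divr_ge0 ?(ltW px) ?(ltW x0).
apply: (@le_trans _ _ ((phi x / x)%:E * (K%:E * (K * x / phi x)%:E))); last first.
  rewrite -!EFinM lee_fin (_ : phi x / x * _ = K * K)%R//.
  by field; rewrite !gt_eqF ?subr_gt0.
apply: lee_wpmul2l; first by rewrite lee_fin.
have sub : `]0%R, x]%classic `<=` I01.
  by move=> y; rewrite /= !in_itv/= => /andP[? ?]; apply/andP; split; lra.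
rewrite -integral_itv_obnd_cbnd; last exact: measurable_rearrangement.
apply: le_trans (lee_wpmul2l _ (integral_inv x01)); last by rewrite lee_fin ltW.
rewrite -integral_itv_obnd_cbnd; last exact: mg.
rewrite -ge0_integralZl_EFin ?(ltW K_gt0)//; last 2 first.
- by move=> y _; rewrite lee_fin inv_piece_ge0.
- exact: mg.
apply: ge0_le_integral => //.
- by move=> y _; exact: rearrangement_ge0.
- exact: measurable_rearrangement.
- by apply: emeasurable_funM => //; exact: mg.
move=> y; rewrite /= in_itv/= => /andP[y0 yx].
apply: le_trans (rearrangement_inv_le _) _; first by apply/andP; split; lra.
by rewrite -EFinM lee_fin /inv_piece ifT//; apply/andP; split; lra.
Qed.

Lemma cesaro_marcinkiewicz_inv : cesaro_space (marcinkiewicz_space phi) f.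
Proof.
split => //; split; first exact: cesaro_measurable.
  exists [set (0%R : R)]; split => //; first exact: lebesgue_measure_set1.
  move=> x; apply: contra_notP => x0 /=; rewrite in_itv/= => /andP[x0' x1].
  have {x0'}x0 : (0 < x)%R.
    by rewrite lt_neqAle x0' andbT eq_sym; apply/eqP.
  rewrite ge0_fin_numE ?cesaro_ge0 ?(ltW x0)//.
  by apply: le_lt_trans (cesaro_inv_le _) (ltry _); rewrite x0.
by apply: le_lt_trans marcinkiewicz_inv_le (ltry _).
Qed.

End upper_bound.

(** The piece has integral at least b / (2 phi(b)), so its average is at least 1 / (4 phi(b)) on ]b,
    2 b]. This interval has length b, which bounds the rearrangement below on [0, b[; the norm is
    then tested at t = b, where phi(b) cancels. *)
Lemma marcinkiewicz_piece_ge b : (0 < b)%R -> (2 * b <= 1)%R ->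
  (4^-1)%:E <= cesaro_norm (marcinkiewicz_norm phi) (inv_piece (b / 2) b).
Proof.
move=> b0 b1; set f := inv_piece _ _; have mf : measurable_fun I01 f.
  exact: measurable_inv_piece.
have pb : (0 < phi b)%R by apply: phi_pos => //; lra.
have pb0 : (0 <= phi b / b)%R by rewrite divr_ge0 ?(ltW pb) ?(ltW b0).
have f0 x : (0 <= f x)%R by apply: inv_piece_ge0; lra.
have fint : (b / 2 / phi b)%:E <= \int[lambda]_(s in `[0%R, b]) `|f s|%:E.
  apply: (@le_trans _ _ (\int[lambda]_(s in `](b / 2)%R, b]) ((phi b)^-1)%:E)).
    rewrite integral_cst//= lebesgue_measure_itv/= lte_fin ifT; last by lra.
    by rewrite -EFinB -EFinM lee_fin mulrC ler_pM2l ?invr_gt0//; lra.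
  have sub : `](b / 2)%R, b]%classic `<=` `[0%R, b]%classic.
    by move=> y; rewrite /= !in_itv/= => /andP[? ?]; apply/andP; split; lra.
  have mabs : measurable_fun `[0%R, b] (fun s => `|f s|%:E).
    apply/measurable_EFinP; apply: measurableT_comp => //.
    by apply: measurable_funS mf => //; apply: subset_itvl; rewrite bnd_simp; lra.
  apply: (@le_trans _ _ (\int[lambda]_(s in `](b / 2)%R, b]) `|f s|%:E)).
    apply: ge0_le_integral => //.
    - by move=> s _; rewrite lee_fin invr_ge0 ltW.
    - exact: measurable_funS mabs.
    move=> s; rewrite /= in_itv/= => /andP[bs sb].
    rewrite lee_fin ger0_norm// /f /inv_piece bs sb/=.
    rewrite lef_pV2 ?posrE ?phi_pos//; try lra.
    by apply: (le_phi phi_nd); lra.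
  exact: ge0_subset_integral.
have rge s : (0 <= s)%R -> (s < b)%R ->
    ((4 * phi b)^-1)%:E <= rearrangement (C f) s.
  move=> s0 sb; apply: (@rearrangement_ge _ _ _ _ `]b, (2 * b)%R]) => //.
  - exact: cesaro_measurable.
  - by move=> y; rewrite /= !in_itv/= => /andP[? ?]; apply/andP; split; lra.
  - rewrite lebesgue_measure_itv/= lte_fin ifT; last by lra.
    by rewrite lte_fin; lra.
  move=> x; rewrite /= in_itv/= => /andP[bx xb].
  have x0 : (0 < x)%R by lra.
  rewrite gee0_abs ?cesaro_ge0 ?(ltW x0)//.
  have -> : ((4 * phi b)^-1 = (2 * b)^-1 * (b / 2 / phi b))%R.
    by field; rewrite !gt_eqF.
  rewrite EFinM; apply: lee_pmul.
  - by rewrite lee_fin invr_ge0; lra.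
  - by rewrite lee_fin divr_ge0 ?(ltW pb)//; lra.
  - by rewrite lee_fin lef_pV2 ?posrE//; lra.
  apply: le_trans fint _; apply: primitive_le => //; lra.
apply: (@le_trans _ _ ((phi b / b)%:E *
    \int[lambda]_(s in `[0%R, b]) rearrangement (C f) s)); last first.
  apply: ereal_sup_ubound; exists b => //=; rewrite in_itv/= b0/=; lra.
rewrite -integral_itv_bndo_bndc; last exact: measurable_rearrangement.
apply: (@le_trans _ _ ((phi b / b)%:E *
    \int[lambda]_(s in `[0%R, b[) ((4 * phi b)^-1)%:E)).
  rewrite integral_cst//= lebesgue_measure_itv/= lte_fin b0 sube0 -!EFinM lee_fin.
  rewrite (_ : phi b / b * _ = 4^-1)%R//.
  by field; rewrite !gt_eqF.
apply: lee_wpmul2l; first by rewrite lee_fin.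
apply: ge0_le_integral => //.
- by move=> s _; rewrite lee_fin invr_ge0 mulr_ge0// ltW.
- exact: measurable_rearrangement.
by move=> s; rewrite /= in_itv/= => /andP[s0 sb]; exact: rge.
Qed.

Lemma cesaro_marcinkiewicz_not_AL :
  ~ order_isomorphic_to_AL_space
    (cesaro_space (marcinkiewicz_space phi)) (cesaro_norm (marcinkiewicz_norm phi)).
Proof.
(* The sequence starts at 1/2 so that ]b, 2 b], where the average is tested, stays inside the unit
   interval. *)
pose b n : R := (2^-1 ^+ n.+1)%R.
have b_gt0 n : (0 < b n)%R by rewrite exprn_gt0// invr_gt0.
have bS n : (b n.+1 = b n / 2)%R by rewrite /b exprSr.
have ble n : (2 * b n <= 1)%R.
  by rewrite /b exprS mulrA divff// mul1r exprn_ile1 ?invr_ge0 ?invf_le1 ?ler1n.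
have bmono n : (b n <= b 0%N)%R.
  elim: n => // n ih; apply: le_trans ih; rewrite bS; have := b_gt0 n; lra.
have inD a c : (0 <= a)%R -> (c <= 1)%R ->
    cesaro_space (marcinkiewicz_space phi) (inv_piece a c).
  move=> a0 c1; apply: cesaro_marcinkiewicz_inv; first exact: measurable_inv_piece.
  by move=> x _; rewrite ger0_norm ?inv_piece_ge0// inv_piece_le.
have b1 n : (b n <= 1)%R by have := ble n; have := b_gt0 n; lra.
(* The partial sum of the first [n] pieces is again a piece, on ]b n, b 0], empty for [n = 0]. The
   zero function is the piece [inv_piece 1 0]. *)
apply: (@not_AL_disjoint_sequence R (cesaro_space (marcinkiewicz_space phi))
  (cesaro_norm (marcinkiewicz_norm phi)) (fun n => inv_piece (b n.+1) (b n))
  (fun n => inv_piece (b n) (b 0%N)) g (4^-1)%R) => //.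
- rewrite (_ : cst 0%R = inv_piece 1 0); last first.
    apply/funext => x; rewrite /inv_piece ifF//.
    by apply/negbTE/negP => /andP[? ?]; lra.
  exact: inD.
- exact: inD.
- by move=> n; apply: inD => //; exact: ltW.
- by move=> n; apply: inD => //; exact: ltW.
- by move=> n x; apply: inv_piece_ge0 => //; exact: ltW.
- by move=> n x; rewrite inv_piece_ge0 ?inv_piece_le// ltW.
- move=> n x; rewrite /inv_piece; have := bmono n; have := b_gt0 n; have := bS n.
  move=> bn b0 b01; have [bx|xb] := ltP (b n.+1) x; last first.
    have -> : (b n < x)%R = false by apply/negbTE; rewrite -leNgt; lra.
    by rewrite addr0.
  have [xbn|bnx] := leP x (b n).
    by rewrite (le_trans xbn b01) add0r.
  by rewrite addr0.
- move=> n x; rewrite /inv_piece; have [bx|xb]/= := ltP (b n) x.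
    rewrite andbF; case: ifP => // xb; rewrite min_r// invr_ge0 phi_ge0// in01//.
      by rewrite ltW// (lt_trans (b_gt0 n)).
    exact: le_trans xb (b1 _).
  rewrite andbT; case: ifP => [bx|_]; last by rewrite minxx.
  rewrite min_l// invr_ge0 phi_ge0// in01//; last exact: le_trans xb (b1 _).
  by rewrite ltW// (lt_trans (b_gt0 n.+1)).
by move=> n; rewrite bS; exact: marcinkiewicz_piece_ge.
Qed.

End marcinkiewicz.

Theorem theorem3p6 (R : realType) (phi : R -> R)
    (phi_ge0 : {in `[0, 1], forall x, 0 <= phi x})
    (phi_nd : {in `[0, 1] &, {homo phi : x y / x <= y}})
    (phi_concave : @convex_function R R^o `[0, 1] (fun x => - phi x))
    (phi0 : phi 0 = 0)
    (gamma_gt0 : 0 < lower_dilation_index phi)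
    (gamma_le_delta : lower_dilation_index phi <= upper_dilation_index phi)
    (delta_lt1 : upper_dilation_index phi < 1) :
  order_isomorphic_to_AL_space
    (cesaro_space (lorentz_space phi)) (cesaro_norm (lorentz_norm phi)) /\
  ~ order_isomorphic_to_AL_space
    (cesaro_space (marcinkiewicz_space phi))
    (cesaro_norm (marcinkiewicz_norm phi)).
Proof.
have [p1 _] := lower_dilation_index_gt0P phi_ge0 phi_nd phi_concave phi0 gamma_gt0.
split; first exact: cesaro_lorentz_AL.
(* The lower index transfers its positivity to the upper one, which certifies that the upper limit
   exists. *)
have delta01 : 0 < upper_dilation_index phi < 1.
  by rewrite (lt_le_trans gamma_gt0 gamma_le_delta).
have [t [q [t1 /andP[q0 q1] pq]]] :=
  upper_dilation_index_lt1P phi_concave phi0 p1 delta01.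
exact: (cesaro_marcinkiewicz_not_AL phi_ge0 phi_nd phi_concave phi0 p1 t1 q0 q1 pq).
Qed.
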